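(* Let $d\ge 1$ and consider a percolation game on $\mathbb{Z}^d$ that is i.i.d. and oriented. There is a constant $v_\infty\in\mathbb{R}$ such that for all $z\in\mathbb{Z}^d$, $v_n(z)$ converges $\mathbb{P}$-almost surely to $v_\infty$ as $n$ tends to infinity. Moreover, there exist $A,B>0$ such that for all $n\ge 1$, all $z\in\mathbb{Z}^d$ and all $\lambda\ge 0$, $$\mathbb{P}\left(|v_n(z)-v_\infty|\ge \lambda+A\,\ln(n+1)^{1/2}\,n^{-1/2}\right)\le \exp\left(-B\lambda^2 n\right).$$ In particular, $\mathbb{E}(v_n)$ converges to $v_\infty$ at a rate $O(\ln(n)\,n^{-1/2})$, where $\mathbb{E}(v_n)$ denotes the expectation $\mathbb{E}(v_n(z))$, which does not depend on $z$.
   Context: A percolation game on $\mathbb{Z}^d$ ($d\ge1$) is a tuple $\Gamma=(I,J,\Omega,g,q)$ where: - $I$ and $J$ are finite nonempty sets (the action sets of Player 1 and Player 2). - $(\Omega,\mathcal{F},\mathbb{P})$ is a probability space equipped with measurable transformations $\tau_z:\Omega\to\Omega$, $z\in\mathbb{Z}^d$, such that for all $z,z'\in\mathbb{Z}^d$ and $F\in\mathcal{F}$, $\mathbb{P}(\tau_z(F))=\mathbb{P}(F)$ and $\tau_{z+z'}=\tau_z\circ\tau_{z'}$. Moreover the family is ergodic: if $F\in\mathcal{F}$ satisfies $\tau_z(F)=F$ for all $z\in\mathbb{Z}^d$, then $\mathbb{P}(F)\in\{0,1\}$. - $g=(\omega\mapsto g_\omega(z,i,j))_{(z,i,j)\in\mathbb{Z}^d\times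 I\times J}$ is a collection of real-valued random variables on $\Omega$, uniformly bounded and stationary: $g_{\tau_z(\omega)}(z',i,j)=g_\omega(z+z',i,j)$ for all $z,z'\in\mathbb{Z}^d$, $i\in I$, $j\in J$, $\omega\in\Omega$. - $q:I\times J\to\mathbb{Z}^d$ is the transition function. Given an initial state $z_1=z\in\mathbb{Z}^d$ and $\omega\in\Omega$, the players are informed of $\omega$. At each stage $m\ge1$, Player 1 chooses $i_m\in I$; then, knowing $i_m$, Player 2 chooses $j_m\in J$; Player 1 receives $g_\omega(z_m,i_m,j_m)$ and Player 2 receives $-g_\omega(z_m,i_m,j_m)$; the new state is $z_{m+1}=z_m+q(i_m,j_m)$. A strategy of Player 1 is a collection $\sigma$ of mappings $\sigma_m:(\mathbb{Z}^d\times I\times J)^{m-1}\times\mathbb{Z}^d\to I$, $m\ge1$; a strategy of Player 2 is a collection $\rho$ of mappings $\rho_m:(\mathbb{Z}^d\times I\times J)^{m-1}\times\mathbb{Z}^d\times I\to J$, $m\ge1$. Let $\Sigma$ and $T$ be the corresponding strategy sets. An initial state $z$ and a pair $(\sigma,\rho)\in\Sigma\times T$ induce a sequence $(z_m,i_m,j_m)_{m\ge1}$, and the $n$-stage payoff is $$\gamma_n^\omega(z,\sigma,\rho)=\frac1n\sum_{m=1}^n g_\omega(z_m,i_m,j_m).$$ The value of the $n$-stage game is $$v_n^\omega(z)=\max_{\sigma\in\Sigma}\min_{\rho\in T}\gamma_n^\omega(z,\sigma,\rho)=\min_{\rho\in T}\max_{\sigma\in\Sigma}\gamma_n^\omega(z,\sigma,\rho),$$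 and $v_n(z)$ denotes the random variable $\omega\mapsto v_n^\omega(z)$. The game is oriented if there exists $u\in\mathbb{Z}^d$ such that $q(i,j)\cdot u>0$ for all $(i,j)\in I\times J$. The game is i.i.d. if the random variables $\omega\mapsto (g_\omega(z,i,j))_{(i,j)\in I\times J}$, $z\in\mathbb{Z}^d$, are independent and identically distributed. (The components for different $(i,j)$ at the same $z$ may be dependent.) *)

(* Defs.v *)
From HB Require Import structures.
From mathcomp Require Import all_boot all_order all_algebra.
From mathcomp Require Import all_classical all_reals all_analysis.
From mathcomp Require Import finmap measurable_realfun.
Set Implicit Arguments.
Unset Strict Implicit.
Unset Printing Implicit Defensive.
Import Order.TTheory GRing.Theory Num.Theory.
Import numFieldNormedType.Exports.
Local Open Scope classical_set_scope.
Local Open Scope ring_scope.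

Section independence.
Context {disp disp' : measure_display} {Omega : measurableType disp}
  {T : measurableType disp'} {R : realType} (P : probability Omega R)
  {K : choiceType} (X : K -> Omega -> T).

Definition mutually_independent : Prop :=
  forall (S : {fset K}) (B : K -> set T), (forall k, measurable (B k)) ->
  P (\bigcap_(k in [set` S]) (X k @^-1` B k)) =
    (\prod_(k <- S) P (X k @^-1` B k))%E.

Definition identically_distributed : Prop :=
  forall (k k' : K) (B : set T), measurable B ->
  P (X k @^-1` B) = P (X k' @^-1` B).

End independence.

Definition dotz (d : nat) (x y : 'rV[int]_d) : int :=
  \sum_(k < d) x ord0 k * y ord0 k.

(* [pg_tau_image] is what makes [P (tau z @` F)] meaningful; it is automatic
   when [tau 0] is the identity, which is not required here. *)
Record percolation_game (R : realType) (d : nat) (I J : finType)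
    (disp : measure_display) (Omega : measurableType disp)
    (P : probability Omega R) := PercolationGame {
  pg_I_nonempty : (0 < #|I|)%N ;
  pg_J_nonempty : (0 < #|J|)%N ;
  pg_tau : 'rV[int]_d -> Omega -> Omega ;
  pg_tau_measurable : forall z, measurable_fun [set: Omega] (pg_tau z) ;
  pg_tau_image : forall z (F : set Omega),
    measurable F -> measurable (pg_tau z @` F) ;
  pg_tau_preserving : forall z (F : set Omega),
    measurable F -> P (pg_tau z @` F) = P F ;
  pg_tauD : forall z z', pg_tau (z + z') = pg_tau z \o pg_tau z' ;
  pg_ergodic : forall F : set Omega, measurable F ->
    (forall z, pg_tau z @` F = F) -> P F = 0%E \/ P F = 1%E ;
  pg_g : Omega -> 'rV[int]_d -> I -> J -> R ;
  pg_g_measurable : forall z i j,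
    measurable_fun [set: Omega] (fun w => pg_g w z i j) ;
  pg_g_bounded : exists M : R, forall w z i j, `|pg_g w z i j| <= M ;
  pg_g_stationary : forall w z z' i j,
    pg_g (pg_tau z w) z' i j = pg_g w (z + z') i j ;
  pg_q : I -> J -> 'rV[int]_d
}.

Section game.
Context {R : realType} {d : nat} {I J : finType} {disp : measure_display}
  {Omega : measurableType disp} {P : probability Omega R}
  (G : @percolation_game R d I J disp Omega P).

Local Notation state := 'rV[int]_d.
Local Notation g := (pg_g G).
Local Notation q := (pg_q G).

Definition oriented : Prop :=
  exists u : state, forall i j, 0 < dotz (q i j) u.

(* The random vector (g(z,i,j))_{(i,j)}, indexed by the enumeration of I * J so
   as to use the product sigma-algebra on tuples. *)
Definition payoff_vector (z : state) (w : Omega) : #|{: I * J}|.-tuple R :=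
  codom_tuple (fun p : I * J => g w z p.1 p.2).

Definition iid : Prop :=
  mutually_independent P payoff_vector /\
  identically_distributed P payoff_vector.

(* Stages are numbered from 0: component m of a strategy is used at stage m.+1,
   after a history of m past triples (state, action 1, action 2). *)
Definition strategy1 : Type :=
  forall m : nat, m.-tuple (state * I * J) -> state -> I.
Definition strategy2 : Type :=
  forall m : nat, m.-tuple (state * I * J) -> state -> I -> J.

Section play.
Variables (z : state) (s : strategy1) (r : strategy2).

Fixpoint play (m : nat) : m.-tuple (state * I * J) * state :=
  match m with
  | 0%N => ([tuple], z)
  | m'.+1 =>
      let: (h, x) := play m' in
      let i := s h x in
      let j := r h x i in
      ([tuple of rcons h (x, i, j)], x + q i j)
  end.

Definition play_state (m : nat) : state := (play m).2.
Definition play_action1 (m : nat) : I := s (play m).1 (play m).2.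
Definition play_action2 (m : nat) : J :=
  r (play m).1 (play m).2 (play_action1 m).

Definition mean_payoff (n : nat) (w : Omega) : R :=
  n%:R^-1 *
  \sum_(m < n) g w (play_state m) (play_action1 m) (play_action2 m).

End play.

Definition value (n : nat) (w : Omega) (z : state) : R :=
  sup [set inf [set mean_payoff z s r n w | r in [set: strategy2]]
      | s in [set: strategy1]].

(* The rest of the section shows that the game has optimal strategies, so that
   [value] is indeed max min = min max, and that it is measurable in [w]. *)

Lemma saddle_value n w z (v : R) s0 r0 :
  (forall r, v <= mean_payoff z s0 r n w) ->
  (forall s, mean_payoff z s r0 n w <= v) -> value n w z = v.
Proof.
move=> lo up.
have bd s : has_lbound [set mean_payoff z s r n w | r in [set: strategy2]].
  have [M gM] := pg_g_bounded G.
  exists (n%:R^-1 * - (\sum_(m < n) M)) => _ [r _ <-].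
  rewrite /mean_payoff ler_wpM2l ?invr_ge0// -sumrN ler_sum// => m _.
  by have := gM w (play_state z s r m) (play_action1 z s r m)
    (play_action2 z s r m); rewrite ler_norml => /andP[].
have infle s : inf [set mean_payoff z s r n w | r in [set: strategy2]] <= v.
  by apply: le_trans (up s); apply: ge_inf (bd s) _ _; exists r0.
apply/eqP; rewrite eq_le; apply/andP; split.
  apply: ge_sup; first by exists (inf [set mean_payoff z s0 r n w | r in setT]), s0.
  by move=> _ [s _ <-].
apply: (@le_trans _ _ (inf [set mean_payoff z s0 r n w | r in [set: strategy2]])).
  by apply: lb_le_inf; [exists (mean_payoff z s0 r0 n w), r0|move=> _ [r _ <-]].
by apply: ub_le_sup; [exists v => _ [s _ <-]|exists s0].
Qed.

Section dynamic_programming.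
Variables (i0 : I) (j0 : J).

Fixpoint total_value (n : nat) (w : Omega) (z : state) : R :=
  if n is m.+1 then
    let Q i j := g w z i j + total_value m w (z + q i j) in
    let F i := \big[Num.min/Q i j0]_(j : J) Q i j in
    \big[Num.max/F i0]_(i : I) F i
  else 0.

Let gain w m z i j := g w z i j + total_value m w (z + q i j).

Lemma best1 w m z : {i | forall j, total_value m.+1 w z <= gain w m z i j}.
Proof.
pose F i := \big[Num.min/gain w m z i j0]_(j : J) gain w m z i j.
case: (@Order.TotalTheory.arg_maxP _ _ _ i0 xpredT F isT) => i _ Fi.
exists i => j; apply: (@le_trans _ _ (F i)); last exact: bigmin_le.
by apply/bigmax_leP; split => [|i' _]; exact: Fi.
Qed.

Lemma best2 w m z i : {j | gain w m z i j <= total_value m.+1 w z}.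
Proof.
pose F i := \big[Num.min/gain w m z i j0]_(j : J) gain w m z i j.
case: (@Order.TotalTheory.arg_minP _ _ _ j0 xpredT (gain w m z i) isT) => j _ Fj.
exists j; apply: (@le_trans _ _ (F i)); last exact: le_bigmax.
by apply/bigmin_geP; split => [|j' _]; exact: Fj.
Qed.

Definition opt1 n w : strategy1 :=
  fun m _ x => if (n - m)%N is k.+1 then sval (best1 w k x) else i0.
Definition opt2 n w : strategy2 :=
  fun m _ x i => if (n - m)%N is k.+1 then sval (best2 w k x i) else j0.

Let partial w z s r m : R :=
  \sum_(k < m) g w (play_state z s r k) (play_action1 z s r k)
    (play_action2 z s r k).

Lemma play_stateS z s r m : play_state z s r m.+1 =
  play_state z s r m + q (play_action1 z s r m) (play_action2 z s r m).
Proof.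
by rewrite /play_state /play_action2 /play_action1 /=; case: (play z s r m).
Qed.

Lemma opt1P n w m (h : m.-tuple (state * I * J)) z j : (m < n)%N ->
  total_value (n - m) w z <= gain w (n - m.+1) z (opt1 n w h z) j.
Proof.
move=> mn; rewrite /opt1 subnS.
have [k ->] : exists k, (n - m)%N = k.+1.
  by exists (n - m.+1)%N; rewrite subnSK.
by case: (best1 w k z).
Qed.

Lemma opt2P n w m (h : m.-tuple (state * I * J)) z i : (m < n)%N ->
  gain w (n - m.+1) z i (opt2 n w h z i) <= total_value (n - m) w z.
Proof.
move=> mn; rewrite /opt2 subnS.
have [k ->] : exists k, (n - m)%N = k.+1.
  by exists (n - m.+1)%N; rewrite subnSK.
by case: (best2 w k z i).
Qed.

Lemma opt1_total n w z r m : (m <= n)%N ->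
  total_value n w z <=
  partial w z (opt1 n w) r m +
  total_value (n - m) w (play_state z (opt1 n w) r m).
Proof.
elim: m => [_|m IH mn]; first by rewrite /partial big_ord0 add0r subn0.
apply: (le_trans (IH (ltnW mn))).
by rewrite /partial big_ord_recr/= -addrA lerD2l play_stateS opt1P.
Qed.

Lemma opt2_total n w z s m : (m <= n)%N ->
  partial w z s (opt2 n w) m +
  total_value (n - m) w (play_state z s (opt2 n w) m) <= total_value n w z.
Proof.
elim: m => [_|m IH mn]; first by rewrite /partial big_ord0 add0r subn0.
apply: le_trans (IH (ltnW mn)).
by rewrite /partial big_ord_recr/= -addrA lerD2l play_stateS opt2P.
Qed.

Lemma opt_saddle n w z :
  (forall r, n%:R^-1 * total_value n w z <= mean_payoff z (opt1 n w) r n w) /\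
  (forall s, mean_payoff z s (opt2 n w) n w <= n%:R^-1 * total_value n w z).
Proof.
split => [r|s]; rewrite /mean_payoff ler_wpM2l ?invr_ge0//.
  by have := @opt1_total n w z r n (leqnn n); rewrite subnn addr0.
by have := @opt2_total n w z s n (leqnn n); rewrite subnn addr0.
Qed.

Lemma measurable_total_value n z :
  measurable_fun [set: Omega] (fun w => total_value n w z).
Proof.
elim: n z => [|n IH] z /=; first exact: measurable_cst.
have mQ i j : measurable_fun [set: Omega] (fun w => gain w n z i j).
  by apply: measurable_funD => //; exact: pg_g_measurable.
have mF i : measurable_fun [set: Omega]
    (fun w => \big[Num.min/gain w n z i j0]_(j : J) gain w n z i j).
  elim: (index_enum J) => [|j js IHj].
    by under eq_fun do rewrite big_nil; exact: mQ.
  under eq_fun do rewrite big_cons.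
  exact: measurable_minr.
elim: (index_enum I) => [|i js IHi].
  by under eq_fun do rewrite big_nil; exact: mF.
under eq_fun do rewrite big_cons.
by apply: measurable_maxr; [exact: mF|exact: IHi].
Qed.

End dynamic_programming.

Lemma value_saddle n w z : exists (s0 : strategy1) (r0 : strategy2),
  (forall r, value n w z <= mean_payoff z s0 r n w) /\
  (forall s, mean_payoff z s r0 n w <= value n w z).
Proof.
have [i0 _] := card_gt0P (pg_I_nonempty G).
have [j0 _] := card_gt0P (pg_J_nonempty G).
have [lo up] := opt_saddle i0 j0 n w z.
by exists (opt1 i0 j0 n w), (opt2 i0 j0 n w); rewrite (saddle_value lo up).
Qed.

Lemma measurable_value n z :
  measurable_fun [set: Omega] (fun w => value n w z).
Proof.
have [i0 _] := card_gt0P (pg_I_nonempty G).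
have [j0 _] := card_gt0P (pg_J_nonempty G).
under eq_fun => w.
  have [lo up] := opt_saddle i0 j0 n w z.
  rewrite (saddle_value lo up).
  over.
by apply: measurable_funM; [exact: measurable_cst|exact: measurable_total_value].
Qed.

End game.

(* Main.v *)
(** Let [V n z] be the total value of the [n]-stage game, given by dynamic
    programming. As the game is oriented, a play crosses each layer
    [{z | dotz z u = l}] at most once, so changing the payoffs on one layer moves
    [V n z] by a bounded amount, and [V n z] depends on O(n) layers. Layers being
    independent, the bounded difference inequality gives
    [E exp (s (V - E V)) <= exp (C s^2 n)], hence Gaussian concentration at scale
    [n ^ (1/2)]. After [m] stages only polynomially many states are reachable, so
    the maximum of [V n] over them exceeds its mean by O((n ln m) ^ (1/2)); hence
    [E V (m + n) = E V m + E V n + O((n ln m) ^ (1/2))]. This near additivity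
    makes [E V n / n] converge at rate [(ln n / n) ^ (1/2)]. *)

Require Import Defs.
From HB Require Import structures.
From mathcomp Require Import all_boot all_order all_algebra.
From mathcomp Require Import all_classical all_reals all_analysis.
From mathcomp Require Import finmap measurable_realfun ring lra zify.
Import Order.TTheory GRing.Theory Num.Theory.
Import numFieldNormedType.Exports.
Local Open Scope classical_set_scope.
Local Open Scope ring_scope.

Set Implicit Arguments.
Unset Strict Implicit.
Unset Printing Implicit Defensive.

(** * Expectations of bounded measurable functions *)

Section bounded_measurable.
Context {d : measure_display} {T : measurableType d} {R : realType}.

(** This class is stable under the operations used below and integrable for every probability, so no
    integrability condition has to be carried along. *)
Definition bounded_measurable (f : T -> R) :=
  measurable_fun [set: T] f /\ exists C, forall x, `|f x| <= C.

Lemma bmeas_cst c : bounded_measurable (fun=> c).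
Proof. by split; [exact: measurable_cst|exists `|c|]. Qed.

Lemma bmeasD f g : bounded_measurable f -> bounded_measurable g ->
  bounded_measurable (fun x => f x + g x).
Proof.
move=> [mf [C fC]] [mg [C' gC]]; split; first exact: measurable_funD.
by exists (C + C') => x; rewrite (le_trans (ler_normD _ _))// lerD.
Qed.

Lemma bmeasM f g : bounded_measurable f -> bounded_measurable g ->
  bounded_measurable (fun x => f x * g x).
Proof.
move=> [mf [C fC]] [mg [C' gC]]; split; first exact: measurable_funM.
by exists (C * C') => x; rewrite normrM ler_pM.
Qed.

Lemma bmeasN f : bounded_measurable f -> bounded_measurable (fun x => - f x).
Proof.
move=> [mf [C fC]]; split; first exact: measurableT_comp.
by exists C => x; rewrite normrN.
Qed.

Lemma bmeasB f g : bounded_measurable f -> bounded_measurable g ->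
  bounded_measurable (fun x => f x - g x).
Proof. by move=> ? ?; apply: bmeasD => //; exact: bmeasN. Qed.

Lemma bmeas_expR f : bounded_measurable f ->
  bounded_measurable (fun x => expR (f x)).
Proof.
move=> [mf [C fC]]; split; first exact: measurableT_comp.
exists (expR C) => x; rewrite ger0_norm ?expR_ge0// ler_expR.
exact: le_trans (ler_norm _) _.
Qed.

Lemma bmeas_sum (I : Type) (s : seq I) (f : I -> T -> R) :
  (forall i, bounded_measurable (f i)) ->
  bounded_measurable (fun x => \sum_(i <- s) f i x).
Proof.
move=> bf; elim: s => [|i s IH].
  by under eq_fun do rewrite big_nil; exact: bmeas_cst.
by under eq_fun do rewrite big_cons; exact: bmeasD.
Qed.

End bounded_measurable.

Lemma bmeas_comp {d d'} {T : measurableType d} {T' : measurableType d'}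
    {R : realType} (f : T' -> R) (phi : T -> T') :
  measurable_fun setT phi -> bounded_measurable f ->
  bounded_measurable (fun x => f (phi x)).
Proof.
by move=> mphi [mf [C fC]]; split; [exact: measurableT_comp|exists C].
Qed.

Section mean.
Context {d : measure_display} {T : measurableType d} {R : realType}
  (P : probability T R).

Lemma bmeas_integrable f : bounded_measurable f ->
  P.-integrable [set: T] (EFin \o f).
Proof.
move=> [mf [C fC]]; apply: measurable_bounded_integrable => //.
  by rewrite ltey_eq fin_num_measure.
exists C; split; first exact: num_real.
by move=> M CM x _ /=; rewrite (le_trans (fC x))// ltW.
Qed.

Lemma mean_cst c : \int[P]_x c = c.
Proof. by rewrite Rintegral_cst//= probability_setT/= mulr1. Qed.

Lemma meanD f g : bounded_measurable f -> bounded_measurable g ->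
  \int[P]_x (f x + g x) = \int[P]_x f x + \int[P]_x g x.
Proof. by move=> bf bg; rewrite RintegralD//; exact: bmeas_integrable. Qed.

Lemma meanZ c f : bounded_measurable f ->
  \int[P]_x (c * f x) = c * \int[P]_x f x.
Proof. by move=> bf; rewrite RintegralZl//; exact: bmeas_integrable. Qed.

Lemma meanN f : bounded_measurable f ->
  \int[P]_x (- f x) = - \int[P]_x f x.
Proof.
move=> bf; rewrite -mulN1r -meanZ//.
by apply: eq_Rintegral => x _; rewrite mulN1r.
Qed.

Lemma meanB f g : bounded_measurable f -> bounded_measurable g ->
  \int[P]_x (f x - g x) = \int[P]_x f x - \int[P]_x g x.
Proof. by move=> bf bg; rewrite meanD ?meanN//; exact: bmeasN. Qed.

Lemma le_mean f g : bounded_measurable f -> bounded_measurable g ->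
  (forall x, f x <= g x) -> \int[P]_x f x <= \int[P]_x g x.
Proof.
by move=> bf bg fg; apply: le_Rintegral => //; exact: bmeas_integrable.
Qed.

Lemma mean_sum (I : Type) (s : seq I) (f : I -> T -> R) :
  (forall i, bounded_measurable (f i)) ->
  \int[P]_x (\sum_(i <- s) f i x) = \sum_(i <- s) \int[P]_x f i x.
Proof.
move=> bf; elim: s => [|i s IH].
  under eq_Rintegral do rewrite big_nil.
  by rewrite big_nil mean_cst.
under eq_Rintegral do rewrite big_cons.
by rewrite big_cons meanD ?IH//; exact: bmeas_sum.
Qed.

Lemma mean_norm_le f C : bounded_measurable f -> (forall x, `|f x| <= C) ->
  `|\int[P]_x f x| <= C.
Proof.
move=> bf fC; rewrite ler_norml -{1}(mean_cst (- C)) -{2}(mean_cst C).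
by apply/andP; split; apply: le_mean => // [|x];
  try exact: bmeas_cst; have := fC x; rewrite ler_norml => /andP[].
Qed.

Lemma EFin_mean f : bounded_measurable f ->
  (\int[P]_x (f x)%:E)%E = (\int[P]_x f x)%:E.
Proof.
move=> bf; rewrite /Rintegral fineK//.
exact: (integrable_fin_num measurableT (bmeas_integrable bf)).
Qed.

Lemma mean_expectation f : bounded_measurable f ->
  ('E_P[f] = (\int[P]_x f x)%:E)%E.
Proof. by move=> bf; rewrite unlock -EFin_mean. Qed.

End mean.

Section product_mean.
Context {d1 d2 : measure_display} {T1 : measurableType d1}
  {T2 : measurableType d2} {R : realType}
  (P1 : probability T1 R) (P2 : probability T2 R).

(* Measurability of the inner integral is only available through a product
   measure, so an arbitrary probability is put on the first factor. *)
Lemma bmeas_partial_mean (f : T1 * T2 -> R) : bounded_measurable f ->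
  bounded_measurable (fun x => \int[P2]_y f (x, y)).
Proof.
move=> bf.
have bfx x : bounded_measurable (fun y => f (x, y)).
  by apply: bmeas_comp bf; exact: measurable_pair1.
have [mf [C fC]] := bf.
split; last first.
  by exists C => x; apply: mean_norm_le.
apply/measurable_EFinP.
rewrite (_ : _ \o _ = fun x => (\int[P2]_y (EFin \o f) (x, y))%E).
  pose P0 : probability T1 R := dirac point.
  apply: (@measurable_fubini_F _ _ _ _ _ P0 P2 (EFin \o f)).
  exact: (bmeas_integrable (P0 \x P2)%E).
by apply/funext => x /=; rewrite -EFin_mean.
Qed.

Lemma mean_fubini (f : T1 * T2 -> R) : bounded_measurable f ->
  \int[P1]_x \int[P2]_y f (x, y) = \int[(P1 \x P2)%E]_z f z.
Proof.
move=> bf; apply: EFin_inj; rewrite -EFin_mean; last exact: bmeas_partial_mean.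
rewrite -(EFin_mean (P1 \x P2)%E)//.
rewrite -(@integral12_prod_meas1 _ _ _ _ _ P1 P2 (EFin \o f)).
  apply: eq_integral => x _; rewrite /fubini_F /= -EFin_mean//.
  by apply: bmeas_comp bf; exact: measurable_pair1.
exact: bmeas_integrable.
Qed.

End product_mean.

Lemma mean_distribution {d d'} {T : measurableType d} {T' : measurableType d'}
    {R : realType} (P : probability T R) (X : {mfun T >-> T'}) (f : T' -> R) :
  bounded_measurable f ->
  \int[distribution P X]_y f y = \int[P]_x f (X x).
Proof.
move=> bf; apply: EFin_inj; rewrite -!EFin_mean//; last first.
  by apply: bmeas_comp bf.
rewrite integral_pushforward//; first by apply/measurable_EFinP; case: bf.
by apply: bmeas_integrable; apply: bmeas_comp bf.
Qed.

(** Two laws that agree on a generating pi-system coincide, by Dynkin's uniqueness theorem, and so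
    do their integrals. *)
Lemma eq_mean_law {d1 d2 d'} {T1 : measurableType d1} {T2 : measurableType d2}
    {T' : measurableType d'} {R : realType} (P1 : probability T1 R)
    (P2 : probability T2 R) (X1 : T1 -> T') (X2 : T2 -> T')
    (G : set (set T')) (f : T' -> R) :
  @measurable _ T' = <<s G >> -> setI_closed G -> G setT ->
  measurable_fun setT X1 -> measurable_fun setT X2 ->
  (forall A, G A -> P1 (X1 @^-1` A) = P2 (X2 @^-1` A)) ->
  bounded_measurable f ->
  \int[P1]_x f (X1 x) = \int[P2]_x f (X2 x).
Proof.
move=> mG GI GT mX1 mX2 eqG bf.
pose Y1 : {mfun T1 >-> T'} := HB.pack X1 (isMeasurableFun.Build _ _ _ _ _ mX1).
pose Y2 : {mfun T2 >-> T'} := HB.pack X2 (isMeasurableFun.Build _ _ _ _ _ mX2).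
rewrite -(mean_distribution P1 Y1 bf) -(mean_distribution P2 Y2 bf).
congr fine; apply: eq_measure_integral => A mA _.
apply: (@measure_unique _ _ _ G (fun=> setT)) => //.
- by rewrite bigcup_const//; exists 0%N.
- by move=> _; rewrite ltey_eq fin_num_measure.
Qed.

(** * Random fields with the product sigma-algebra *)

Section random_field.
Context {K : choiceType} {dT : measure_display} (T : measurableType dT).

(** Finite-dimensional boxes: a pi-system generating the product sigma-algebra, on which
    independence determines the joint law. *)
Definition cylinders : set (set (K -> T)) :=
  [set A | exists (S : {fset K}) (B : K -> set T),
     (forall k, measurable (B k)) /\ A = [set x | forall k, k \in S -> B k (x k)]].

Definition field_space := g_sigma_algebraType cylinders.

Lemma cylinders_setI : setI_closed cylinders.
Proof.
move=> _ _ [S1 [B1 [mB1 ->]]] [S2 [B2 [mB2 ->]]].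
(* Each box is extended by [setT] off its own index set, where its sides are arbitrary. *)
exists (S1 `|` S2)%fset, (fun k => (if k \in S1 then B1 k else setT) `&`
  (if k \in S2 then B2 k else setT)); split.
  by move=> k; apply: measurableI; case: ifP.
apply/seteqP; split => x /=.
  by move=> [x1 x2] k _; split; case: ifPn => // kS; [exact: x1|exact: x2].
move=> x12; split => k kS.
  by have := x12 k; rewrite inE kS /= => /(_ isT)[].
by have := x12 k; rewrite inE kS orbT => /(_ isT)[].
Qed.

Lemma cylinders_setT : cylinders setT.
Proof.
exists fset0, (fun=> setT); split => //.
by apply/seteqP; split => x.
Qed.

Lemma measurable_field_coord k :
  measurable_fun [set: field_space] (fun x : field_space => x k).
Proof.
move=> _ B mB; rewrite setTI; apply: sub_sigma_algebra.
exists [fset k]%fset, (fun=> B); split => //.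
apply/seteqP; split => x /=; last by apply; rewrite inE.
by move=> Bx k'; rewrite inE => /eqP ->.
Qed.

Lemma preimage_cylinder {Omega : Type} (X : Omega -> K -> T) (S : {fset K})
    (B : K -> set T) :
  X @^-1` [set x | forall k, k \in S -> B k (x k)] =
  \bigcap_(k in [set` S]) ((X ^~ k) @^-1` B k).
Proof. by apply/seteqP; split => w /= h k /h. Qed.

Lemma measurable_fun_field {d} {Omega : measurableType d}
    (X : Omega -> field_space) :
  (forall k, measurable_fun setT (fun w => X w k)) ->
  measurable_fun setT X.
Proof.
move=> mX; apply: (measurability (cylinders : set (set field_space))) => // _ [_ [S [B [mB ->]]] <-].
rewrite setTI preimage_cylinder; apply: fin_bigcap_measurable => //.
by move=> k _; rewrite -[X in measurable X]setTI; exact: mX.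
Qed.

(** Averaging over [y] drawn from an independent copy amounts to conditioning on the coordinates in
    [A]. *)
Definition mix (A : pred K) (x y : field_space) : field_space :=
  fun k => if A k then x k else y k.

Lemma measurable_mix {d} {Omega : measurableType d} (A : pred K)
    (X Y : Omega -> field_space) :
  measurable_fun setT X -> measurable_fun setT Y ->
  measurable_fun setT (fun w => mix A (X w) (Y w)).
Proof.
move=> mX mY; apply: measurable_fun_field => k; rewrite /mix; case: (A k).
- exact: (measurableT_comp (measurable_field_coord k) mX).
- exact: (measurableT_comp (measurable_field_coord k) mY).
Qed.

End random_field.

(** * Resampling part of an independent field *)

Section resampling.
Context {K : choiceType} {dT d : measure_display} {T : measurableType dT}
  {Omega : measurableType d} {R : realType} (P : probability Omega R)
  (X : K -> Omega -> T).
Hypothesis mX : forall k, measurable_fun setT (X k).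
Hypothesis indepX : mutually_independent P X.

Definition field_of (w : Omega) : field_space (K := K) T := X ^~ w.

Lemma measurable_field_of : measurable_fun setT field_of.
Proof. exact: measurable_fun_field. Qed.

Lemma bmeas_field_of (f : field_space T -> R) :
  bounded_measurable f -> bounded_measurable (fun w => f (field_of w)).
Proof. exact: bmeas_comp measurable_field_of. Qed.

Lemma bmeas_mix (A : pred K) (f : field_space T -> R) (x : field_space T) :
  bounded_measurable f -> bounded_measurable (fun y => f (mix A x y)).
Proof.
move=> bf; apply: (bmeas_comp _ bf); apply: measurable_mix.
- exact: measurable_cst.
- exact: measurable_id.
Qed.

(* Independence: the coordinates outside [A] may be replaced by those of an
   independent copy of the field. *)
Lemma mean_mix (A : pred K) (f : field_space T -> R) : bounded_measurable f ->
  \int[P]_w f (field_of w) =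
  \int[P]_w \int[P]_w' f (mix A (field_of w) (field_of w')).
Proof.
move=> bf.
pose V (ww : Omega * Omega) := mix A (field_of ww.1) (field_of ww.2).
have mV : measurable_fun setT V.
  apply: measurable_mix.
  - exact: (measurableT_comp measurable_field_of measurable_fst).
  - exact: (measurableT_comp measurable_field_of measurable_snd).
rewrite (mean_fubini P P (bmeas_comp mV bf)).
apply: (@eq_mean_law _ _ _ _ _ (field_space T) _ P (P \x P)%E field_of V
  (@cylinders K _ T) f) => //.
- exact: cylinders_setI.
- exact: cylinders_setT.
- exact: measurable_field_of.
move=> _ [S [B [mB ->]]].
rewrite (preimage_cylinder field_of) indepX//.
pose B1 k := if A k then B k else setT.
pose B2 k := if A k then setT else B k.
have mB1 k : measurable (B1 k) by rewrite /B1; case: ifP.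
have mB2 k : measurable (B2 k) by rewrite /B2; case: ifP.
have mXB k C : measurable C -> measurable (X k @^-1` C).
  by move=> mC; rewrite -[X in measurable X]setTI; exact: mX.
(* Constraints on coordinates in [A] bear on the first copy, the others on the second, so the
   preimage is a rectangle and its product measure factors. *)
rewrite (_ : V @^-1` _ =
  (\bigcap_(k in [set` S]) (X k @^-1` B1 k)) `*`
  (\bigcap_(k in [set` S]) (X k @^-1` B2 k))); last first.
  apply/seteqP; split => -[w w'] /=.
    move=> h; split => k kS; have := h k kS; rewrite /V /mix /B1 /B2 /=;
    by case: (A k).
  move=> [h1 h2] k kS; have := h1 k kS; have := h2 k kS.
  by rewrite /V /mix /B1 /B2 /=; case: (A k).
transitivity (P (\bigcap_(k in [set` S]) X k @^-1` B1 k) *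
  P (\bigcap_(k in [set` S]) X k @^-1` B2 k))%E; last first.
  by symmetry; apply: product_measure1E; apply: fin_bigcap_measurable => //;
    move=> k _; exact: mXB.
rewrite !indepX// -big_split; apply: eq_bigr => k _ /=.
by rewrite /B1 /B2; case: (A k); rewrite preimage_setT probability_setT
  ?mule1 ?mul1e.
Qed.

End resampling.

(** * Exponential moments under bounded differences *)

Lemma expR_le_addr {R : realType} (y : R) : expR y <= y + expR (4 * y ^+ 2).
Proof.
(* Up to 1/4 a quadratic bound on [expR y] is enough; beyond 1/4 already [y <= 4 * y ^+ 2]. *)
have [y4|y4] := leP y (4^-1).
  (* Since [1 - y / 2 <= expR (- (y / 2))], the product of [(1 - y / 2) ^+ 2] and [expR y] is at
     most 1, while its product with [1 + y + y ^+ 2] is at least 1 in this range. *)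
  have : expR y <= 1 + y + y ^+ 2.
    have h1 : 0 < 1 - y / 2 by lra.
    have h : (1 - y / 2) ^+ 2 * expR y <= 1.
      rewrite (_ : expR y = expR (y / 2) ^+ 2); last first.
        by rewrite -expRM_natl; congr expR; lra.
      rewrite -exprMn; apply: exprn_ile1; first by rewrite mulr_ge0 ?expR_ge0// ltW.
      have /(ler_wpM2r (expR_ge0 (y / 2))) := expR_ge1Dx (- (y / 2)).
      by rewrite -expRD addNr expR0.
    have h2 : (1 - y / 2) ^+ 2 * expR y <= (1 - y / 2) ^+ 2 * (1 + y + y ^+ 2).
      apply: (le_trans h); nra.
    by rewrite ler_pM2l ?exprn_gt0// in h2.
  have := expR_ge1Dx (4 * y ^+ 2).
  by have := sqr_ge0 y; lra.
apply: (@le_trans _ _ (expR (4 * y ^+ 2))); last by lra.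
by rewrite ler_expR; nra.
Qed.

(** Apply [expR_le_addr] to [s * (h u - m)]: the linear term integrates to 0, and only the term
    quadratic in the exponent remains. *)
Lemma mgf_centered {R : realType} {d} {U : measurableType d}
    (Q : probability U R)
    (h : U -> R) (m c s : R) : bounded_measurable h ->
  \int[Q]_u h u = m -> (forall u, `|h u - m| <= c) ->
  \int[Q]_u expR (s * h u) <= expR (s * m) * expR (4 * (s * c) ^+ 2).
Proof.
move=> bh hm hc.
have bs : bounded_measurable (fun u => s * h u) by apply: bmeasM => //; exact: bmeas_cst.
apply: (@le_trans _ _ (\int[Q]_u (expR (s * m) *
    (s * (h u - m) + expR (4 * (s * c) ^+ 2))))).
  apply: le_mean; first exact: bmeas_expR.
    apply: bmeasM; first exact: bmeas_cst.
    apply: bmeasD; last exact: bmeas_cst.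
    apply: bmeasM; first exact: bmeas_cst.
    by apply: bmeasB => //; exact: bmeas_cst.
  move=> u; rewrite (_ : s * h u = s * m + s * (h u - m)); last by ring.
  rewrite expRD ler_pM2l ?expR_gt0//.
  apply: (le_trans (expR_le_addr _)); rewrite lerD2l ler_expR.
  rewrite !exprMn ler_pM2l// ler_wpM2l ?sqr_ge0//.
  by rewrite -(ger0_norm (sqr_ge0 (_ - _))) normrX lerXn2r ?nnegrE// (le_trans _ (hc u)).
have bhm : bounded_measurable (fun u => h u - m).
  by apply: bmeasB => //; exact: bmeas_cst.
rewrite meanZ.
  rewrite ler_pM2l ?expR_gt0// meanD; last exact: bmeas_cst.
    rewrite meanZ// meanB//; last exact: bmeas_cst.
    by rewrite !mean_cst hm subrr mulr0 add0r.
  by apply: bmeasM => //; exact: bmeas_cst.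
apply: bmeasD; last exact: bmeas_cst.
by apply: bmeasM => //; exact: bmeas_cst.
Qed.

Section bounded_differences.
Context {K : choiceType} {dT d : measure_display} {T : measurableType dT}
  {Omega : measurableType d} {R : realType} (P : probability Omega R)
  (X : K -> Omega -> T).
Hypothesis mX : forall k, measurable_fun setT (X k).
Hypothesis indepX : mutually_independent P X.

Variables (f : field_space (K := K) T -> R) (A : nat -> pred K) (c : R) (N : nat).
Hypothesis bf : bounded_measurable f.
Hypothesis subA : forall k z, A k z -> A k.+1 z.
Hypothesis f0 : forall x y, f (mix (A 0) x y) = f y.
Hypothesis fN : forall x y, f (mix (A N) x y) = f x.
Hypothesis fc : forall k x y,
  (forall z, ~~ (A k.+1 z && ~~ A k z) -> x z = y z) -> `|f x - f y| <= c.

Let F := field_of X.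
(* [M k (F w)] is the conditional expectation of [f \o F] given the coordinates
   in [A k]; the Azuma-Hoeffding argument is run on this martingale. *)
Let M k x : R := \int[P]_w f (mix (A k) x (F w)).

Let bfmix B x : bounded_measurable (fun w => f (mix B x (F w))).
Proof.
exact: (bmeas_field_of mX (bmeas_mix B x bf)).
Qed.

Let bM k : bounded_measurable (M k).
Proof.
apply: (bmeas_partial_mean P
  (f := fun xw : field_space T * Omega => f (mix (A k) xw.1 (F xw.2)))).
apply: (bmeas_comp (phi := fun xw : field_space T * Omega =>
  mix (A k) xw.1 (F xw.2)) _ bf).
  apply: measurable_mix; first exact: measurable_fst.
  exact: (measurableT_comp (measurable_field_of mX) measurable_snd).
Qed.

(** The tower property of conditional expectation, at the level of fields. *)
Let mixA k (x y y' : field_space T) : mix (A k.+1) (mix (A k) x y) y' =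
  mix (A k) x (mix (A k.+1) y y').
Proof.
apply/funext => z; rewrite /mix; have := @subA k z.
by case: (A k z) => [->|].
Qed.

Let be s k : bounded_measurable (fun x => expR (s * M k x)).
Proof. by apply: bmeas_expR; apply: bmeasM (bM _); exact: bmeas_cst. Qed.

(** Conditionally on the coordinates in [A k], [M k.+1] has mean [M k] and deviates from it by at
    most [c], so [mgf_centered] applies for each fixed [w]. *)
Let M_step k s : \int[P]_w expR (s * M k.+1 (F w)) <=
  \int[P]_w expR (s * M k (F w)) * expR (4 * (s * c) ^+ 2).
Proof.
have be' := bmeas_field_of mX (be s k).
rewrite (mean_mix mX indepX (A k) (be s k.+1)).
rewrite [leRHS]mulrC -meanZ//.
apply: le_mean.
- apply: (bmeas_field_of mX
   (f := fun x => \int[P]_w' expR (s * M k.+1 (mix (A k) x (F w'))))).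
  apply: (bmeas_partial_mean P (f := fun xw : field_space T * Omega =>
    expR (s * M k.+1 (mix (A k) xw.1 (F xw.2))))).
  apply: (bmeas_comp (phi := fun xw : field_space T * Omega =>
    mix (A k) xw.1 (F xw.2)) _ (be s k.+1)).
  apply: measurable_mix; first exact: measurable_fst.
  exact: (measurableT_comp (measurable_field_of mX) measurable_snd).
- by apply: bmeasM => //; exact: bmeas_cst.
move=> w; rewrite mulrC; apply: mgf_centered.
- apply: (bmeas_field_of mX
    (f := fun y => M k.+1 (mix (A k) (F w) y))).
  exact: bmeas_mix (bM _).
- rewrite /M [RHS](mean_mix mX indepX (A k.+1) (bmeas_mix _ _ bf)).
  apply: eq_Rintegral => w' _; apply: eq_Rintegral => w'' _.
  by rewrite mixA.
(* Coupling both averages through the same [w''] leaves two fields that differ only on [A k.+1]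
   minus [A k]. *)
move=> w'; rewrite /M -meanB//; apply: mean_norm_le; first exact: bmeasB.
move=> w''; apply: (fc (k := k)) => z.
by rewrite /mix; have := @subA k z; case: (A k z); case: (A k.+1 z) => //= /(_ isT).
Qed.

(** [M 0] is the constant mean because [f] ignores [A 0], and [M N] is [f] because [f] sees only
    [A N]; each of the [N] steps in between costs a factor [expR (4 * (s * c) ^+ 2)]. *)
Lemma mgf_bounded_differences (s : R) :
  \int[P]_w expR (s * (f (F w) - \int[P]_w' f (F w'))) <=
  expR (4 * N%:R * (s * c) ^+ 2).
Proof.
pose m := \int[P]_w' f (F w').
have step k : \int[P]_w expR (s * M k (F w)) <=
    expR (s * m) * expR (4 * k%:R * (s * c) ^+ 2).
  elim: k => [|k IH].
    rewrite mulr0 mul0r expR0 mulr1.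
    under eq_Rintegral => w _.
      rewrite /M; under eq_Rintegral do rewrite f0.
      over.
    by rewrite mean_cst.
  apply: (le_trans (M_step k s)).
  apply: (le_trans (ler_wpM2r (expR_ge0 _) IH)).
  rewrite -(mulrA (expR (s * m))) -expRD.
  by have -> : 4 * k%:R * (s * c) ^+ 2 + 4 * (s * c) ^+ 2 =
    4 * k.+1%:R * (s * c) ^+ 2 by rewrite -natr1; ring.
have bfF : bounded_measurable (fun w => f (F w)).
  exact: (bmeas_field_of mX bf).
rewrite (@eq_Rintegral _ _ _ _ _
  (fun w => expR (- (s * m)) * expR (s * M N (F w)))).
  rewrite meanZ; last exact: (bmeas_field_of mX (be s N)).
  apply: (le_trans (ler_wpM2l (expR_ge0 _) (step N))).
  by rewrite mulrA -expRD addNr expR0 mul1r.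
move=> w _; rewrite -expRD /M -/m; congr expR.
under eq_Rintegral do rewrite fN.
by rewrite mean_cst; ring.
Qed.

End bounded_differences.

(** * The dynamic programming recursion *)

Lemma dotzD (d : nat) (x y u : 'rV[int]_d) :
  dotz (x + y) u = dotz x u + dotz y u.
Proof.
by rewrite /dotz -big_split; apply: eq_bigr => k _; rewrite mxE mulrDl.
Qed.

Section dynamic_program.
Context {R : realType} {d : nat} {I J : finType}.
Variables (i0 : I) (j0 : J) (q : I -> J -> 'rV[int]_d).
Local Notation state := 'rV[int]_d.
Implicit Types (phi psi : state -> I -> J -> R) (z : state).

(** The recursion of [total_value] with the payoff field as an argument, so that two fields can be
    compared and a field resampled. *)
Fixpoint dyn phi (n : nat) z : R :=
  if n is m.+1 then
    let Q i j := phi z i j + dyn phi m (z + q i j) in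
    let F i := \big[Num.min/Q i j0]_(j : J) Q i j in
    \big[Num.max/F i0]_(i : I) F i
  else 0.

Lemma dyn_best1 phi n z : exists i, forall j,
  dyn phi n.+1 z <= phi z i j + dyn phi n (z + q i j).
Proof.
pose Q i j := phi z i j + dyn phi n (z + q i j).
pose F i := \big[Num.min/Q i j0]_(j : J) Q i j.
case: (@Order.TotalTheory.arg_maxP _ _ _ i0 xpredT F isT) => i _ Fi.
exists i => j; apply: (@le_trans _ _ (F i)); last exact: bigmin_le.
by apply/bigmax_leP; split => [|i' _]; exact: Fi.
Qed.

Lemma dyn_best2 phi n z i : exists j,
  phi z i j + dyn phi n (z + q i j) <= dyn phi n.+1 z.
Proof.
pose Q i j := phi z i j + dyn phi n (z + q i j).
pose F i := \big[Num.min/Q i j0]_(j : J) Q i j.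
case: (@Order.TotalTheory.arg_minP _ _ _ j0 xpredT (Q i) isT) => j _ Fj.
exists j; apply: (@le_trans _ _ (F i)); last exact: le_bigmax.
by apply/bigmin_geP; split => [|j' _]; exact: Fj.
Qed.

(** Player 1 takes an action optimal for [phi] and Player 2 a reply optimal for [psi], so a bound
    valid for every pair of actions passes to the values. *)
Lemma dyn_le_step phi psi n n' z z' (c : R) :
  (forall i j, phi z i j + dyn phi n (z + q i j) <=
               psi z' i j + dyn psi n' (z' + q i j) + c) ->
  dyn phi n.+1 z <= dyn psi n'.+1 z' + c.
Proof.
move=> h; have [i hi] := dyn_best1 phi n z.
have [j hj] := dyn_best2 psi n' z' i.
by apply: (le_trans (hi j)); apply: (le_trans (h i j)); rewrite lerD2r.
Qed.

Lemma dyn_shift phi z n z' : dyn (fun y => phi (z + y)) n z' = dyn phi n (z + z').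
Proof.
elim: n z' => [//|n IH] z'.
apply/eqP; rewrite eq_le -[leRHS]addr0 -[X in _ && (_ <= X)]addr0.
by apply/andP; split; apply: dyn_le_step => i j; rewrite addr0 IH addrA.
Qed.

Lemma dyn_norm_le phi (M : R) n z : (forall z i j, `|phi z i j| <= M) ->
  `|dyn phi n z| <= n%:R * M.
Proof.
move=> phiM; elim: n z => [|n IH] z; first by rewrite normr0 mul0r.
rewrite -natr1 mulrDl mul1r ler_norml; apply/andP; split.
  have [j hj] := dyn_best2 phi n z i0; apply: le_trans hj.
  by rewrite opprD addrC lerD//; have := phiM z i0 j; have := IH (z + q i0 j);
    rewrite !ler_norml => /andP[? _] /andP[].
have [i hi] := dyn_best1 phi n z; apply: (le_trans (hi j0)).
by rewrite addrC lerD//; have := phiM z i j0; have := IH (z + q i j0);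
  rewrite !ler_norml => /andP[_ ?] /andP[].
Qed.

Lemma measurable_dyn {disp} {Omega : measurableType disp}
    (phi : Omega -> state -> I -> J -> R) n z :
  (forall z i j, measurable_fun setT (fun w => phi w z i j)) ->
  measurable_fun setT (fun w => dyn (phi w) n z).
Proof.
move=> mphi; elim: n z => [|n IH] z /=; first exact: measurable_cst.
have mQ i j : measurable_fun setT
    (fun w => phi w z i j + dyn (phi w) n (z + q i j)).
  exact: measurable_funD.
have mF i : measurable_fun setT (fun w =>
    \big[Num.min/phi w z i j0 + dyn (phi w) n (z + q i j0)]_(j : J)
      (phi w z i j + dyn (phi w) n (z + q i j))).
  elim: (index_enum J) => [|j js IHj].
    by under eq_fun do rewrite big_nil; exact: mQ.
  under eq_fun do rewrite big_cons.
  exact: measurable_minr.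
elim: (index_enum I) => [|i js IHi].
  by under eq_fun do rewrite big_nil; exact: mF.
under eq_fun do rewrite big_cons.
by apply: measurable_maxr; [exact: mF|exact: IHi].
Qed.

(** * Effect of the orientation on the recursion *)

Section oriented.
Variables (u : state) (D : nat).
Hypothesis q_gt0 : forall i j, 0 < dotz (q i j) u.
Hypothesis q_le : forall i j, dotz (q i j) u <= D%:Z.

(** Every move raises [dotz z u] by at least 1 and at most [D], so [n] stages see only the payoffs
    on [D * n] consecutive layers. *)
Lemma dyn_local_le phi psi n z :
  (forall z' i j, dotz z u <= dotz z' u < dotz z u + (D * n)%:Z ->
    phi z' i j = psi z' i j) ->
  dyn phi n z <= dyn psi n z.
Proof.
elim: n z => [//|n IH] z h.
rewrite -[leRHS]addr0; apply: dyn_le_step => i j.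
have q0 := q_gt0 i j; have qD := q_le i j.
rewrite addr0 lerD//; first by rewrite h//; lia.
by apply: IH => z' i' j'; rewrite !dotzD => h'; apply: h; lia.
Qed.

Lemma dyn_local phi psi n z :
  (forall z' i j, dotz z u <= dotz z' u < dotz z u + (D * n)%:Z ->
    phi z' i j = psi z' i j) ->
  dyn phi n z = dyn psi n z.
Proof.
move=> h; apply/eqP; rewrite eq_le !dyn_local_le// => z' i j /h ->//.
Qed.

(* A play crosses each layer [dotz z u = l] at most once. *)
Lemma dyn_layer_le phi psi (M : R) n z (l : int) : 0 <= M ->
  (forall z i j, `|phi z i j| <= M) -> (forall z i j, `|psi z i j| <= M) ->
  (forall z' i j, dotz z' u != l -> phi z' i j = psi z' i j) ->
  dyn phi n z <= dyn psi n z + 2 * M.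
Proof.
move=> M0 phiM psiM h; elim: n z => [|n IH] z; first by rewrite add0r mulr_ge0.
apply: dyn_le_step => i j; have q0 := q_gt0 i j.
have [zl|/h ->] := eqVneq (dotz z u) l; last by rewrite -addrA lerD2l.
(* From layer [l] all later states lie strictly above it, so the continuations agree and only the
   current payoff changes, by at most [2 * M]. *)
rewrite (@dyn_local phi psi); last first.
  by move=> z' i' j' h'; apply: h; rewrite dotzD in h'; lia.
have := phiM z i j; have := psiM z i j; rewrite !ler_norml; lra.
Qed.

Lemma dyn_layer phi psi (M : R) n z (l : int) : 0 <= M ->
  (forall z i j, `|phi z i j| <= M) -> (forall z i j, `|psi z i j| <= M) ->
  (forall z' i j, dotz z' u != l -> phi z' i j = psi z' i j) ->
  `|dyn phi n z - dyn psi n z| <= 2 * M.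
Proof.
move=> M0 phiM psiM h.
have h1 := dyn_layer_le n z M0 phiM psiM h.
have h2 := @dyn_layer_le psi phi M n z l M0 psiM phiM
  (fun z i j h' => esym (h z i j h')).
by rewrite ler_norml; lra.
Qed.

End oriented.

(* The state reached from [z] when each pair of actions [p] has been played
   [a p] times. *)
Definition reach z (a : I * J -> nat) : state :=
  z + \sum_(p : I * J) q p.1 p.2 *+ a p.

Lemma reach0 z : reach z (fun=> 0%N) = z.
Proof. by rewrite /reach big1 ?addr0. Qed.

Lemma reachS z i j a :
  reach (z + q i j) a = reach z (fun p => (a p + (p == (i, j)))%N).
Proof.
rewrite /reach; under [in RHS]eq_bigr do rewrite mulrnDr.
rewrite big_split /= -addrA; congr (_ + _); rewrite addrC; congr (_ + _).
rewrite (bigD1 (i, j))//= eqxx big1 ?addr0//.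
by move=> p /negbTE ->.
Qed.

(** The last [n] stages act as a terminal payoff of the [m]-stage game. Recording how often each
    pair of actions is played, without the order, leaves only polynomially many states to
    control. *)
Lemma dyn_split_le phi m n z (b : R) :
  (forall a, (forall p, (a p <= m)%N) -> dyn phi n (reach z a) <= b) ->
  dyn phi (m + n) z <= dyn phi m z + b.
Proof.
elim: m z => [|m IH] z h.
  by rewrite add0r -(reach0 z); exact: h.
rewrite addSn; apply: dyn_le_step => i j; rewrite -addrA lerD2l.
apply: IH => a am; rewrite reachS; apply: h => p.
by rewrite -addn1 leq_add// leq_b1.
Qed.

Lemma dyn_split_ge phi m n z (b : R) :
  (forall a, (forall p, (a p <= m)%N) -> b <= dyn phi n (reach z a)) ->
  dyn phi m z + b <= dyn phi (m + n) z.
Proof.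
elim: m z => [|m IH] z h.
  by rewrite add0r -[in leRHS](reach0 z); exact: h.
rewrite addSn -lerBrDr; apply: dyn_le_step => i j.
rewrite -addrA lerD2l lerBrDr; apply: IH => a am; rewrite reachS; apply: h => p.
by rewrite -addn1 leq_add// leq_b1.
Qed.

End dynamic_program.

Lemma total_value_dyn {R : realType} {d : nat} {I J : finType}
    {disp : measure_display} {Omega : measurableType disp}
    {P : probability Omega R} (G : percolation_game d I J P) i0 j0 n w z :
  total_value G i0 j0 n w z = dyn i0 j0 (pg_q G) (pg_g G w) n z.
Proof.
suff : total_value G i0 j0 n w = dyn i0 j0 (pg_q G) (pg_g G w) n by move=> ->.
by elim: n => [//|n IH]; apply/funext => z' /=; rewrite IH.
Qed.

Lemma value_dyn {R : realType} {d : nat} {I J : finType}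
    {disp : measure_display} {Omega : measurableType disp}
    {P : probability Omega R} (G : percolation_game d I J P) i0 j0 n w z :
  value G n w z = n%:R^-1 * dyn i0 j0 (pg_q G) (pg_g G w) n z.
Proof.
have [lo up] := opt_saddle G i0 j0 n w z.
by rewrite (saddle_value lo up) total_value_dyn.
Qed.

Lemma tnth_codom_tuple (F : finType) (T : Type) (f : F -> T) (k : 'I_#|F|) :
  tnth (codom_tuple f) k = f (enum_val k).
Proof.
rewrite (tnth_nth (f (enum_val k))) /= /codom /image_mem.
by rewrite (nth_map (enum_val k)) -?enum_val_nth -?cardE.
Qed.

(** * Total values as random variables, and stationarity *)

Section game_mean.
Context {R : realType} {d : nat} {I J : finType} {disp : measure_display}
  {Omega : measurableType disp} {P : probability Omega R}
  (G : percolation_game d I J P).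
Variables (i0 : I) (j0 : J) (M : R).
Hypothesis gM : forall w z i j, `|pg_g G w z i j| <= M.
Local Notation state := 'rV[int]_d.

Definition game_dyn (n : nat) (z : state) (w : Omega) : R :=
  dyn i0 j0 (pg_q G) (pg_g G w) n z.

Definition game_mean (n : nat) : R := \int[P]_w game_dyn n 0 w.

Lemma bmeas_game_dyn n z : bounded_measurable (game_dyn n z).
Proof.
split; first by apply: measurable_dyn => *; exact: pg_g_measurable.
by exists (n%:R * M) => w; exact: dyn_norm_le (gM w).
Qed.

(* [pg_tau G z] need not be onto, but its image has probability 1. *)
Lemma measure_preimage_tau z (F : set Omega) : measurable F ->
  P (pg_tau G z @^-1` F) = P F.
Proof.
move=> mF; set Z := pg_tau G z @` setT.
have mZ : measurable Z by exact: (pg_tau_image G z measurableT).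
have m1 : measurable (pg_tau G z @^-1` F).
  by rewrite -[X in measurable X]setTI; exact: (pg_tau_measurable G z).
rewrite -(pg_tau_preserving G z m1).
have -> : pg_tau G z @` (pg_tau G z @^-1` F) = F `&` Z.
  apply/seteqP; split => [_ [w Fw <-]|x [Fx [w _ wx]]].
    by split => //; exists w.
  by exists w => //=; rewrite wx.
have Z0 : P (~` Z) = 0%E.
  by rewrite probability_setC// (pg_tau_preserving G z measurableT)
    probability_setT subee.
(* The part of [F] outside the image lies in the complement of [Z], which is null. *)
rewrite [RHS](measureDI P mF mZ) [X in (X + _)%E](_ : _ = 0%E) ?add0e//.
apply/eqP; rewrite eq_le measure_ge0 andbT -Z0.
apply: le_measure.
- by rewrite in_setE; exact: measurableD.
- by rewrite in_setE; exact: measurableC.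
- by rewrite setDE; exact: subIsetr.
Qed.

Lemma mean_tau z (f : Omega -> R) : bounded_measurable f ->
  \int[P]_w f (pg_tau G z w) = \int[P]_w f w.
Proof.
move=> bf; apply: (@eq_mean_law _ _ _ _ _ Omega _ P P (pg_tau G z) id
  measurable f) => //.
- by rewrite sigma_algebra_id//; exact: sigma_algebra_measurable.
- by move=> A B; exact: measurableI.
- exact: pg_tau_measurable.
- by move=> A mA; rewrite measure_preimage_tau.
Qed.

(** Shifting the environment by [- z] brings the initial state to [0] and preserves expectations. *)
Lemma mean_game_dyn n z : \int[P]_w game_dyn n z w = game_mean n.
Proof.
rewrite -[LHS](mean_tau (- z)); last exact: bmeas_game_dyn.
apply: eq_Rintegral => w _; rewrite /game_dyn.
have -> : pg_g G (pg_tau G (- z) w) = fun y => pg_g G w (- z + y).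
  by apply/funext => y; do 2 (apply/funext => ?); rewrite pg_g_stationary.
by rewrite dyn_shift addNr.
Qed.

(** * Concentration and near additivity of the total value *)

Section concentration.
Variables (u : state) (D : nat).
Hypothesis q_gt0 : forall i j, 0 < dotz (pg_q G i j) u.
Hypothesis q_le : forall i j, dotz (pg_q G i j) u <= D%:Z.
Hypothesis M0 : 0 <= M.
Hypothesis indepG : mutually_independent P (payoff_vector G).

Let field := field_space (K := state) (#|{: I * J}|.-tuple R).

(* The truncation only makes the payoffs bounded on the whole field space. *)
Let clip (x : field) (z : state) i j : R :=
  Num.max (- M) (Num.min M (tnth (x z) (enum_rank (i, j)))).

Let clip_norm_le x z i j : `|clip x z i j| <= M.
Proof.
rewrite ler_norml /clip le_max lexx/= ge_max ge_min lexx/= andbT.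
by rewrite (le_trans _ M0)// oppr_le0.
Qed.

Let clip_payoff w : clip (field_of (payoff_vector G) w) = pg_g G w.
Proof.
apply/funext => z; apply/funext => i; apply/funext => j.
rewrite /clip /field_of /payoff_vector tnth_codom_tuple enum_rankK /=.
have := gM w z i j; rewrite ler_norml => /andP[h1 h2].
by rewrite min_r// max_r.
Qed.

Let measurable_clip z i j : measurable_fun setT (fun x : field => clip x z i j).
Proof.
apply: measurable_maxr; first exact: measurable_cst.
apply: measurable_minr; first exact: measurable_cst.
exact: (measurableT_comp (measurable_tnth _) (measurable_field_coord z)).
Qed.

(** The constant [4 * N * c ^+ 2] of [mgf_bounded_differences] per stage, with [N = D * n] layers
    and oscillation [c = 2 * M] on each. *)
Definition mgf_constant : R := 16 * D%:R * M ^+ 2.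

Lemma mgf_game_dyn n z (s : R) :
  \int[P]_w expR (s * (game_dyn n z w - game_mean n)) <=
  expR (mgf_constant * s ^+ 2 * n%:R).
Proof.
pose f (x : field) := dyn i0 j0 (pg_q G) (clip x) n z.
have fE w : game_dyn n z w = f (field_of (payoff_vector G) w).
  by rewrite /f clip_payoff.
rewrite -(mean_game_dyn n z).
under eq_Rintegral => w _.
  rewrite fE; under eq_Rintegral do rewrite fE.
  over.
(* The filtration reveals one layer at a time. [A 0] holds only layers below the start, which are
   never visited, and [A (D * n)] covers every payoff that [n] stages can collect. *)
pose A (k : nat) (z' : state) := dotz z' u < dotz z u + k%:Z.
have mG z' : measurable_fun setT (payoff_vector G z').
  apply/measurable_fun_tnthP => k.
  rewrite (_ : _ \o _ = fun w => pg_g G w z' (enum_val k).1 (enum_val k).2).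
    exact: pg_g_measurable.
  by apply/funext => w /=; rewrite tnth_codom_tuple.
have := @mgf_bounded_differences _ _ _ _ _ _ P (payoff_vector G) mG indepG f A
  (2 * M) (D * n)%N _ _ _ _ _ s.
move=> /(_ _ _ _ _ _)/le_trans; apply.
- split; first exact: measurable_dyn.
  by exists (n%:R * M) => x; exact: dyn_norm_le.
- by move=> k z'; rewrite /A; lia.
- move=> x y; apply: (dyn_local i0 j0 q_gt0 q_le) => z' i j /andP[zz' _].
  by rewrite /clip /mix /A ifF//; lia.
- move=> x y; apply: (dyn_local i0 j0 q_gt0 q_le) => z' i j /andP[_ zz'].
  by rewrite /clip /mix /A ifT.
- move=> k x y xy; apply: (@dyn_layer _ _ _ _ i0 j0 (pg_q G) u D q_gt0 q_le
    _ _ M n z (dotz z u + k%:Z)) => //.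
  by move=> z' i j z'l; rewrite /clip xy// /A; lia.
by rewrite ler_expR /mgf_constant natrM; lra.
Qed.

(** Markov's inequality for [expR (s * X)] and [expR (- s * X)], one for each tail, whence the
    factor 2. *)
Lemma chernoff_game_dyn n z (t : R) : (0 < n)%N -> 0 <= t -> 0 < mgf_constant ->
  (P [set w | (t <= `|game_dyn n z w - game_mean n|)%R] <=
   (2 * expR (- (t ^+ 2 / (4 * mgf_constant * n%:R))))%:E)%E.
Proof.
move=> n0 t0 C0; set C := mgf_constant.
have n0' : 0 < n%:R :> R by rewrite ltr0n.
pose X w := game_dyn n z w - game_mean n.
have bX : bounded_measurable X.
  by apply: bmeasB; [exact: bmeas_game_dyn|exact: bmeas_cst].
(* The minimiser of [C * s ^+ 2 * n - s * t], with minimum [- t ^+ 2 / (4 * C * n)]. *)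
pose s := t / (2 * C * n%:R).
have bE (r : R) : bounded_measurable (fun w => expR (r * X w)).
  by apply: bmeas_expR; apply: bmeasM => //; exact: bmeas_cst.
have mS : measurable [set w | (t <= `|X w|)%R].
  have mn : measurable_fun setT (fun w => `|X w|).
    by apply: measurableT_comp => //; case: bX.
  rewrite (_ : mkset _ = (fun w => `|X w|) @^-1` `[t, +oo[).
    by rewrite -[X in measurable X]setTI; exact: mn.
  by apply/seteqP; split => w /=; rewrite in_itv/= andbT.
pose f w := expR (- (s * t)) * (expR (s * X w) + expR (- s * X w)).
have bf : bounded_measurable f.
  by apply: bmeasM; [exact: bmeas_cst|exact: bmeasD].
have indf w : \1_[set w | (t <= `|X w|)%R] w <= f w.
  have s0 : 0 <= s by rewrite divr_ge0// !mulr_ge0// ltW.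
  have fE : f w = expR (s * (X w - t)) + expR (s * (- X w - t)).
    by rewrite /f mulrDr -!expRD; congr (expR _ + expR _); ring.
  rewrite fE indicE; case: (boolP (w \in _)) => [|_]; last first.
    by rewrite addr_ge0// expR_ge0.
  rewrite in_setE /= ler_normr => /orP[tX|tX].
    rewrite -[leLHS]addr0 lerD ?expR_ge0// -expR0 ler_expR.
    by rewrite mulr_ge0// subr_ge0.
  rewrite -[leLHS]add0r lerD ?expR_ge0// -expR0 ler_expR.
  by rewrite mulr_ge0// subr_ge0.
have b1 : bounded_measurable (\1_[set w | (t <= `|X w|)%R] : Omega -> R).
  split; first exact: measurable_indic.
  by exists 1 => w; rewrite indicE; case: (_ \in _); rewrite ?normr1 ?normr0.
have -> : P [set w | (t <= `|X w|)%R] =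
    (\int[P]_w \1_[set w | (t <= `|X w|)%R] w)%:E.
  by rewrite -EFin_mean// integral_indic// setIT.
rewrite lee_fin; apply: (le_trans (le_mean _ b1 bf indf)).
rewrite meanZ; last exact: bmeasD.
rewrite meanD//.
have h r := mgf_game_dyn n z r.
have -> : 2 * expR (- (t ^+ 2 / (4 * C * n%:R))) =
  expR (- (s * t)) * (expR (C * s ^+ 2 * n%:R) + expR (C * (- s) ^+ 2 * n%:R)).
  rewrite sqrrN.
  have half (x y : R) : x * (y + y) = 2 * (x * y) by ring.
  rewrite half -expRD; congr (_ * expR _).
  by rewrite /s; field; rewrite !gt_eqF.
by rewrite ler_wpM2l ?expR_ge0// lerD.
Qed.

(* A maximal inequality: [b] dominates every [s * (V_k - E V_k)], hence their
   maximum; it comes from [y <= L - 1 + exp (y - L)]. *)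
Lemma mean_soft_max (F : finType) n (zs : F -> state) (s L : R) :
  expR L = #|F|%:R * expR (mgf_constant * s ^+ 2 * n%:R) ->
  exists b : Omega -> R, [/\ bounded_measurable b,
    forall w k, s * (game_dyn n (zs k) w - game_mean n) <= b w &
    \int[P]_w b w <= L].
Proof.
move=> LE; pose X k w := expR (s * (game_dyn n (zs k) w - game_mean n)).
have bX k : bounded_measurable (X k).
  apply: bmeas_expR; apply: bmeasM; first exact: bmeas_cst.
  by apply: bmeasB; [exact: bmeas_game_dyn|exact: bmeas_cst].
exists (fun w => (L - 1) + expR (- L) * \sum_(k : F) X k w); split.
- apply: bmeasD; first exact: bmeas_cst.
  by apply: bmeasM; [exact: bmeas_cst|exact: bmeas_sum].
- move=> w k; rewrite (bigD1 k)//=; set rest := \sum_(_ | _) _.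
  have : 0 <= expR (- L) * rest.
    by rewrite mulr_ge0 ?expR_ge0// sumr_ge0// => ? _; exact: expR_ge0.
  have := expR_ge1Dx (- L + s * (game_dyn n (zs k) w - game_mean n)).
  by rewrite expRD -/(X k w); lra.
- rewrite meanD ?meanZ ?mean_cst; first last.
  + by apply: bmeasM; [exact: bmeas_cst|exact: bmeas_sum].
  + exact: bmeas_cst.
  + exact: bmeas_sum.
  rewrite mean_sum// -lerBrDl opprB addrC subrK.
  rewrite expRN mulrC ler_pdivrMr ?expR_gt0// mul1r LE.
  rewrite [leRHS]mulr_natl -sumr_const.
  by apply: ler_sum => k _; exact: mgf_game_dyn.
Qed.

(** After [m] stages the state is among [m.+1 ^ #|{: I * J}|] candidates, and the largest deviation
    of the continuation value over them has expectation at most [L / s], with [L] from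
    [mean_soft_max]. *)
Lemma game_mean_almost_additive m n : (0 < m)%N -> (0 < n)%N ->
  `|game_mean (m + n) - game_mean m - game_mean n| <=
  (#|{: I * J}|%:R + mgf_constant) * Num.sqrt (n%:R * ln m.+1%:R).
Proof.
move=> m0 n0; set c := #|_|%:R; set C := mgf_constant.
have n0' : 0 < n%:R :> R by rewrite ltr0n.
have l0 : 0 < ln m.+1%:R :> R by rewrite ln_gt0// ltr1n.
(* Up to constants, this balances the two terms [c * ln m.+1 / s] and [C * s * n] of [L / s]. *)
pose s := Num.sqrt (ln m.+1%:R / n%:R) : R.
have s0 : 0 < s by rewrite sqrtr_gt0 divr_gt0.
have s2 : s ^+ 2 = ln m.+1%:R / n%:R by rewrite sqr_sqrtr// ltW// divr_gt0.
pose L := c * ln m.+1%:R + C * s ^+ 2 * n%:R.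
have LE : L = s * ((c + C) * Num.sqrt (n%:R * ln m.+1%:R)).
  have -> : Num.sqrt (n%:R * ln m.+1%:R) = s * n%:R :> R.
    rewrite (_ : n%:R * ln m.+1%:R = (s * n%:R) ^+ 2).
      by rewrite sqrtr_sqr ger0_norm// mulr_ge0// ltW.
    by rewrite exprMn s2; field; rewrite gt_eqF.
  have -> : s * ((c + C) * (s * n%:R)) = (c + C) * s ^+ 2 * n%:R by ring.
  rewrite /L s2.
  by field; rewrite gt_eqF.
pose F : finType := {ffun I * J -> 'I_m.+1}.
have FL r : r ^+ 2 = s ^+ 2 -> expR L = #|F|%:R * expR (C * r ^+ 2 * n%:R).
  move=> ->; rewrite expRD card_ffun card_ord natrX; congr (_ * _).
  by rewrite /c mulrC expRM_natr lnK// posrE ltr0n.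
pose zs (k : F) := reach (pg_q G) 0 (fun p => k p).
have zsP a : (forall p, (a p <= m)%N) -> exists k, reach (pg_q G) 0 a = zs k.
  move=> am; exists [ffun p => inord (a p)]; rewrite /zs; congr reach.
  by apply/funext => p; rewrite ffunE inordK// ltnS.
have bg k z := bmeas_game_dyn k z.
rewrite ler_norml; apply/andP; split.
(* The lower bound needs the deviations below the mean, so the maximal inequality is used with
   [- s], which has the same square. *)
- have [b [bb Xb bL]] := mean_soft_max (n := n) zs (FL (- s) (sqrrN s)).
  have key w : game_dyn m 0 w + game_mean n - s^-1 * b w <= game_dyn (m + n) 0 w.
    rewrite -addrA; apply: dyn_split_ge => a /zsP[k ->].
    rewrite lerBlDr -lerBlDl ler_pdivlMl//.
    by have := Xb w k; rewrite mulNr -mulrN opprB.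
  have bb' : bounded_measurable (fun w => s^-1 * b w).
    by apply: bmeasM; first exact: bmeas_cst.
  have b2 : bounded_measurable (fun w => game_dyn m 0 w + game_mean n).
    by apply: bmeasD => //; exact: bmeas_cst.
  have := le_mean P (bmeasB b2 bb') (bg _ _) key.
  rewrite meanB// meanZ// meanD//; last exact: bmeas_cst.
  rewrite mean_cst -!/(game_mean _) => h.
  have : s^-1 * \int[P]_w b w <= (c + C) * Num.sqrt (n%:R * ln m.+1%:R).
    by rewrite ler_pdivrMl// -LE.
  by move: h; set x := s^-1 * _; lra.
- have [b [bb Xb bL]] := mean_soft_max (n := n) zs (FL s erefl).
  have key w : game_dyn (m + n) 0 w <= game_dyn m 0 w + (game_mean n + s^-1 * b w).
    apply: dyn_split_le => a /zsP[k ->].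
    by rewrite -lerBlDl ler_pdivlMl//; exact: Xb.
  have bb' : bounded_measurable (fun w => s^-1 * b w).
    by apply: bmeasM; first exact: bmeas_cst.
  have b2 : bounded_measurable (fun w => game_mean n + s^-1 * b w).
    by apply: bmeasD => //; exact: bmeas_cst.
  have := le_mean P (bg _ _) (bmeasD (bg _ _) b2) key.
  rewrite meanD// meanD//; last exact: bmeas_cst.
  rewrite meanZ// mean_cst -!/(game_mean _) => h.
  have : s^-1 * \int[P]_w b w <= (c + C) * Num.sqrt (n%:R * ln m.+1%:R).
    by rewrite ler_pdivrMl// -LE.
  by move: h; set x := s^-1 * _; lra.
Qed.

End concentration.
End game_mean.

(** * Almost additive real sequences *)

Section almost_additive.
Context {R : realType}.

(* The rate [ln (n + 1) ^ (1/2) * n ^ (- 1/2)]; junk value 0 at [n = 0]. *)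
Definition log_rate (n : nat) : R := Num.sqrt (ln n.+1%:R / n%:R).

Lemma log_rate_ge0 n : 0 <= log_rate n.
Proof. exact: sqrtr_ge0. Qed.

Lemma ln_nat_ge0 n : 0 <= ln n.+1%:R :> R.
Proof. by rewrite ln_ge0// ler1n. Qed.

Lemma sqr_log_rate n : log_rate n ^+ 2 = ln n.+1%:R / n%:R.
Proof. by rewrite sqr_sqrtr// divr_ge0// ln_nat_ge0. Qed.

Lemma le_ln_nat m n k : (m.+1 <= n.+1 ^ k)%N ->
  ln m.+1%:R <= k%:R * ln n.+1%:R :> R.
Proof.
move=> mnk; rewrite mulr_natl -lnXn ?ltr0n// -natrX ler_ln ?posrE ?ltr0n ?expn_gt0//.
by rewrite ler_nat.
Qed.

(** From [4 * n + 1 <= (n + 1) ^ 3] the squared ratio is at most 3/4, which is below [(7 / 8) ^+ 2].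
    A factor below 1 is what sums the errors in [mean_cauchy]. *)
Lemma log_rate_quadruple n : (0 < n)%N -> log_rate (4 * n) <= 7 / 8 * log_rate n.
Proof.
move=> n0; rewrite -(@ler_pXn2r _ 2)// ?nnegrE ?mulr_ge0 ?log_rate_ge0//.
rewrite exprMn !sqr_log_rate natrM.
have n0' : 0 < n%:R :> R by rewrite ltr0n.
have h : ln (4 * n).+1%:R <= 3%:R * ln n.+1%:R :> R.
  by apply: le_ln_nat; rewrite !expnS expn0; nia.
rewrite invfM mulrA ler_pdivrMr// mulrA divfK ?gt_eqF//.
by have := ln_nat_ge0 n; lra.
Qed.

(** As [ln x <= 2 * Num.sqrt x], the fourth power of [log_rate n] is at most [8 / n]. *)
Lemma log_rate_small (e : R) : 0 < e ->
  exists N, forall n, (N < n)%N -> log_rate n <= e.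
Proof.
move=> e0; have e4 : 0 < e ^+ 4 by rewrite exprn_gt0.
exists (Num.bound (16 / e ^+ 4)) => n Nn.
have n0 : (0 < n)%N by apply: leq_ltn_trans Nn.
have n0' : 0 < n%:R :> R by rewrite ltr0n.
have nb : 16 / e ^+ 4 <= n%:R.
  have /ltW := archi_boundP (divr_ge0 (ler0n R 16) (ltW e4)).
  by move/le_trans; apply; rewrite ler_nat ltnW.
rewrite -(@ler_pXn2r _ 4)// ?nnegrE ?log_rate_ge0 ?(ltW e0)//.
have -> : log_rate n ^+ 4 = (log_rate n ^+ 2) ^+ 2 by rewrite -exprM.
rewrite sqr_log_rate; set y := Num.sqrt (n.+1%:R : R).
have y0 : 0 < y by rewrite sqrtr_gt0 ltr0n.
have y2 : y ^+ 2 = n.+1%:R by rewrite sqr_sqrtr.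
have lny : ln n.+1%:R <= 2 * y.
  by rewrite -y2 lnXn// -[leLHS]mulr_natl ler_pM2l// ltW// ln_sublinear.
have ln2 : ln n.+1%:R ^+ 2 <= 8 * n%:R :> R.
  apply: (@le_trans _ _ ((2 * y) ^+ 2)).
    by rewrite lerXn2r// nnegrE ?ln_nat_ge0// mulr_ge0// ltW.
  rewrite exprMn y2 -natr1.
  have : 1 <= n%:R :> R by rewrite ler1n.
  by lra.
rewrite exprMn exprVn ler_pdivrMr ?exprn_gt0//.
apply: (le_trans ln2).
move: nb; rewrite ler_pdivrMr// => nb.
by rewrite expr2 mulrA ler_pM2r// mulrC; lra.
Qed.

Variables (a : nat -> R) (C : R).
Hypothesis C0 : 0 <= C.
Hypothesis a_add : forall m n, (0 < m)%N -> (0 < n)%N ->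
  `|a (m + n)%N - a m - a n| <= C * Num.sqrt (n%:R * ln m.+1%:R).

Let b n := n%:R^-1 * a n.

(** Blocks of length [n] are split off one at a time; the error of each involves the block length
    [n] and the logarithm of a total length of at most [p * n]. *)
Lemma almost_additive_mul p n : (0 < p)%N -> (0 < n)%N ->
  `|a (p * n)%N - p%:R * a n| <= p%:R * (C * Num.sqrt (n%:R * ln (p * n).+1%:R)).
Proof.
move=> + n0; elim: p => [//|[|p] IH] _.
  by rewrite mul1n mul1r subrr normr0 mul1r mulr_ge0 ?sqrtr_ge0.
have h1 := IH isT.
have h2 := @a_add (p.+1 * n)%N n; rewrite muln_gt0 n0 in h2.
have {h2} := h2 isT isT; rewrite addnC -mulSn => h2.
set S := Num.sqrt _ in h1; rewrite -/S in h2.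
set S' := Num.sqrt _.
have SS' : S <= S'.
  apply: ler_wsqrtr; rewrite ler_wpM2l// ler_ln ?posrE ?ltr0n// ler_nat ltnS.
  by rewrite leq_mul2r leqnSn orbT.
have CS : C * S <= C * S' by rewrite ler_wpM2l.
have -> : a (p.+2 * n)%N - p.+2%:R * a n = (a (p.+2 * n)%N - a (p.+1 * n)%N - a n) +
  (a (p.+1 * n)%N - p.+1%:R * a n) by rewrite -natr1; ring.
apply: (le_trans (ler_normD _ _)).
rewrite -[in leRHS]natr1 mulrDl mul1r addrC lerD//.
  by apply: (le_trans h1); rewrite ler_wpM2l.
exact: le_trans CS.
Qed.

Lemma mean_almost_multiple p n : (0 < p)%N -> (0 < n)%N ->
  `|b (p * n) - b n| <= C * Num.sqrt (ln (p * n).+1%:R / n%:R).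
Proof.
move=> p0 n0; have h := almost_additive_mul p0 n0.
have p0' : 0 < p%:R :> R by rewrite ltr0n.
have n0' : 0 < n%:R :> R by rewrite ltr0n.
set l := ln _ in h *.
have -> : Num.sqrt (l / n%:R) = Num.sqrt (n%:R * l) / n%:R.
  rewrite (_ : l / n%:R = n%:R * l / n%:R ^+ 2); last first.
    by field; rewrite gt_eqF.
  rewrite sqrtrM ?mulr_ge0// ?ln_nat_ge0// sqrtrV ?sqr_ge0//.
  by rewrite sqrtr_sqr ger0_norm.
have -> : b (p * n) - b n = (p%:R * n%:R)^-1 * (a (p * n)%N - p%:R * a n).
  by rewrite /b natrM; field; rewrite !gt_eqF.
have pn0 : 0 < (p%:R * n%:R)^-1 :> R by rewrite invr_gt0 mulr_gt0.
rewrite normrM gtr0_norm//.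
apply: (le_trans (ler_wpM2l (ltW pn0) h)).
rewrite le_eqVlt; apply/orP; left; apply/eqP.
by field; rewrite !gt_eqF.
Qed.

(** Both means are compared with the one at the common multiple [p * n]. As
    [p * n + 1 <= (n + 1) ^ 3] and [Num.sqrt 3 <= 2], each comparison costs [2 * C * log_rate n]. *)
Lemma mean_comparable p n : (0 < n)%N -> (n <= p <= 4 * n)%N ->
  `|b p - b n| <= 4 * C * log_rate n.
Proof.
move=> n0 /andP[np p4]; have p0 := leq_trans n0 np.
have n0' : 0 < n%:R :> R by rewrite ltr0n.
have p0' : 0 < p%:R :> R by rewrite ltr0n.
have ln3 : ln (p * n).+1%:R <= 3%:R * ln n.+1%:R :> R.
  by apply: le_ln_nat; rewrite !expnS expn0; nia.
have l0 := ln_nat_ge0 n.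
have bound k : (n <= k)%N ->
    C * Num.sqrt (ln (p * n).+1%:R / k%:R) <= 2 * C * log_rate n.
  move=> nk; have k0' : 0 < k%:R :> R by rewrite ltr0n (leq_trans n0).
  rewrite (mulrC 2) -mulrA; apply: ler_wpM2l => //.
  rewrite -(@ler_pXn2r _ 2)// ?nnegrE ?mulr_ge0 ?log_rate_ge0 ?sqrtr_ge0//.
  rewrite exprMn sqr_log_rate sqr_sqrtr ?divr_ge0 ?ln_nat_ge0//.
  apply: (@le_trans _ _ (ln (p * n).+1%:R / n%:R)).
    by rewrite ler_wpM2l ?ln_nat_ge0// lef_pV2 ?posrE// ler_nat.
  by rewrite mulrA ler_pM2r ?invr_gt0//; lra.
have h1 := le_trans (mean_almost_multiple p0 n0) (bound n (leqnn n)).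
have h2 := mean_almost_multiple n0 p0; rewrite mulnC in h2.
have {}h2 := le_trans h2 (bound p np).
rewrite distrC in h2.
have := ler_distD (b (p * n)) (b p) (b n).
by move: h1 h2; rewrite (distrC (b p)) ; lra.
Qed.

(** Chaining through [4 * n], the errors decrease geometrically by [log_rate_quadruple]; the
    constant 32 solves [4 + 7 / 8 * x = x]. *)
Lemma mean_cauchy n p : (0 < n)%N -> (n <= p)%N ->
  `|b p - b n| <= 32 * C * log_rate n.
Proof.
move: {2}(p - n)%N (leqnn (p - n)) => k; elim/ltn_ind: k n => k IH n pnk n0 np.
have [p4|p4] := leqP p (4 * n).
  apply: (le_trans (mean_comparable n0 _)); first by rewrite np.
  by rewrite ler_wpM2r ?log_rate_ge0// ler_wpM2r//; lra.
have h1 : `|b (4 * n) - b n| <= 4 * C * log_rate n.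
  by apply: mean_comparable => //; lia.
have h2 : `|b p - b (4 * n)| <= 32 * C * log_rate (4 * n).
  by apply: (IH (p - 4 * n)%N) => //; lia.
have h3 : C * log_rate (4 * n) <= C * (7 / 8 * log_rate n).
  by rewrite ler_wpM2l// log_rate_quadruple.
have := ler_distD (b (4 * n)) (b p) (b n).
by move: h1 h2 h3; lra.
Qed.

(* The intervals [b n - D * log_rate n, b n + D * log_rate n] meet pairwise, so
   the supremum of their left endpoints lies in all of them. *)
Lemma almost_additive_limit : exists v : R,
  forall n, (0 < n)%N -> `|n%:R^-1 * a n - v| <= 32 * C * log_rate n.
Proof.
pose D := 32 * C.
have D0 n : 0 <= D * log_rate n by rewrite !mulr_ge0 ?log_rate_ge0.
have cross n p : (0 < n)%N -> (0 < p)%N ->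
    b n - D * log_rate n <= b p + D * log_rate p.
  move=> n0 p0; have := D0 n; have := D0 p; case: (leqP n p) => [np|/ltnW pn].
    by have := mean_cauchy n0 np; rewrite -/D ler_norml; lra.
  by have := mean_cauchy p0 pn; rewrite -/D ler_norml; lra.
pose S := [set b n - D * log_rate n | n in [set n | (0 < n)%N]].
exists (sup S) => n n0; rewrite -/(b n) -/D ler_distlC.
have S0 : S !=set0 by exists (b 1 - D * log_rate 1), 1%N.
apply/andP; split.
  apply: ub_le_sup; last by exists n.
  by exists (b 1 + D * log_rate 1) => _ [m m0 <-]; exact: cross.
by apply: ge_sup => // _ [m m0 <-]; exact: cross.
Qed.

End almost_additive.

(** * From total values to convergence and rates for the value *)

Section conclusion.
Context {R : realType} {d : nat} {I J : finType} {disp : measure_display}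
  {Omega : measurableType disp} {P : probability Omega R}
  (G : percolation_game d I J P).
Variables (i0 : I) (j0 : J) (v D : R).
Hypothesis D0 : 0 <= D.

Let V := game_dyn G i0 j0.
Let a := game_mean G i0 j0.

Hypothesis bV : forall n z, bounded_measurable (V n z).
Hypothesis meanV : forall n z, \int[P]_w V n z w = a n.
Hypothesis a_lim : forall n, (0 < n)%N -> `|n%:R^-1 * a n - v| <= D * log_rate n.

Let valueE n w z : value G n w z = n%:R^-1 * V n z w.
Proof. exact: value_dyn. Qed.

Lemma expectation_value n z : ('E_P[fun w => value G n w z] = (n%:R^-1 * a n)%:E)%E.
Proof.
under eq_fun do rewrite valueE.
rewrite mean_expectation; last by apply: bmeasM => //; exact: bmeas_cst.
by rewrite meanZ// meanV.
Qed.

Lemma expectation_value_cvg z :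
  ('E_P[fun w => value G n w z] @[n --> \oo] --> v%:E)%E.
Proof.
under eq_fun do rewrite expectation_value.
apply: cvg_EFin; first by apply: nearW.
apply/cvgrPdist_le => e e0.
(* [D] may vanish, hence the divisor [D + 1]. *)
have D1 : 0 < D + 1 by rewrite ltr_wpDl.
have [N hN] := log_rate_small (divr_gt0 e0 D1).
exists N.+1 => // n /= Nn; have n0 : (0 < n)%N by apply: leq_ltn_trans Nn.
rewrite distrC /=; apply: (le_trans (a_lim n0)).
have := hN n Nn; rewrite ler_pdivlMr// mulrC mulrDl => /(le_trans _); apply.
by rewrite lerDl mul1r log_rate_ge0.
Qed.

Lemma log_rate_powR n : (0 < n)%N ->
  ln n.+1%:R `^ 2^-1 * n%:R `^ (- 2^-1) = log_rate n :> R.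
Proof.
move=> n0; rewrite powRN !powR12_sqrt ?ln_nat_ge0//.
by rewrite /log_rate sqrtrM ?ln_nat_ge0// sqrtrV.
Qed.

(** The bias has order [Num.sqrt (ln n.+1)] over [Num.sqrt n], and the first root is at most
    [2 * ln n] once [ln n >= 1]. *)
Lemma expectation_value_bigO z :
  (fun n : nat => fine ('E_P[fun w => value G n w z])%E - v : R^o)
    =O_\oo (fun n : nat => ln n%:R * n%:R `^ (- 2^-1) : R^o).
Proof.
apply/eqO_exP; exists (2 * D + 1); first by rewrite ltr_wpDl ?mulr_ge0.
exists 4%N => // n /= n4; have n0 : (0 < n)%N by apply: leq_trans n4.
rewrite expectation_value /=; apply: (le_trans (a_lim n0)).
rewrite -log_rate_powR// normrM [in leRHS](ger0_norm (powR_ge0 _ _)) !mulrA.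
rewrite ler_wpM2r ?powR_ge0//.
(* Here [n >= 4] is used through [expR 1 <= 4], the square of [1 / 2 <= expR (- 2^-1)] inverted. *)
have l1 : 1 <= ln n%:R :> R.
  rewrite -[leLHS](@expRK R) ler_ln ?posrE ?expR_gt0 ?ltr0n//.
  apply: (@le_trans _ _ 4%:R); last by rewrite ler_nat.
  have h : 2^-1 <= expR (- 2^-1) :> R.
    by apply: le_trans (expR_ge1Dx _); lra.
  rewrite -(ler_pM2r (expR_gt0 (-1))) -expRD subrr expR0.
  have -> : -1 = - 2^-1 - 2^-1 :> R by lra.
  by rewrite expRD; nra.
have ll : ln n.+1%:R <= 2%:R * ln n%:R :> R.
  case: n n4 {n0 l1} => // n n4; apply: le_ln_nat.
  by rewrite !expnS expn0; nia.
rewrite ger0_norm ?(le_trans _ l1)// powR12_sqrt ?ln_nat_ge0//.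
have s2 : Num.sqrt (ln n.+1%:R) <= 2 * ln n%:R :> R.
  rewrite -(@ler_pXn2r _ 2)// ?nnegrE ?sqrtr_ge0 ?mulr_ge0 ?(le_trans _ l1)//.
  rewrite sqr_sqrtr ?ln_nat_ge0//; apply: (le_trans ll).
  by move: l1; set x := ln _; nra.
have := ler_wpM2l D0 s2; move: l1; lra.
Qed.

Variable C : R.
Hypothesis C0 : 0 < C.
Hypothesis chernoffV : forall n z (t : R), (0 < n)%N -> 0 <= t ->
  (P [set w | (t <= `|V n z w - a n|)%R] <=
   (2 * expR (- (t ^+ 2 / (4 * C * n%:R))))%:E)%E.

Let measurable_deviation n z (t : R) :
  measurable [set w | (t <= `|value G n w z - v|)%R].
Proof.
have mn : measurable_fun setT (fun w => `|value G n w z - v|).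
  apply: measurableT_comp => //; apply: measurable_funB.
    exact: measurable_value.
  exact: measurable_cst.
rewrite (_ : mkset _ = (fun w => `|value G n w z - v|) @^-1` `[t, +oo[).
  by rewrite -[X in measurable X]setTI; exact: mn.
by apply/seteqP; split => w /=; rewrite in_itv/= andbT.
Qed.

(** The share [D * log_rate n] of the margin absorbs the bias of the mean; the share
    [(4 * C + 1) * log_rate n] absorbs the factor 2 of the Chernoff bound. *)
Lemma value_concentration n z (lambda : R) : (0 < n)%N -> 0 <= lambda ->
  (P [set w | (lambda + (4 * C + 1 + D) * log_rate n <= `|value G n w z - v|)%R]
   <= (expR (- ((4 * C)^-1 * lambda ^+ 2 * n%:R)))%:E)%E.
Proof.
move=> n0 l0; have n0' : 0 < n%:R :> R by rewrite ltr0n.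
set e := log_rate n; have e0 : 0 <= e := log_rate_ge0 n.
pose t := n%:R * (lambda + (4 * C + 1) * e).
have t0 : 0 <= t.
  by rewrite mulr_ge0 ?addr_ge0 ?mulr_ge0// ?addr_ge0 ?mulr_ge0// ltW.
apply: (@le_trans _ _ (P [set w | (t <= `|V n z w - a n|)%R])).
  apply: le_measure.
  - by rewrite in_setE; exact: measurable_deviation.
  - rewrite in_setE.
    have mn : measurable_fun setT (fun w => `|V n z w - a n|).
      apply: measurableT_comp => //; apply: measurable_funB; first by case: (bV n z).
      exact: measurable_cst.
    rewrite (_ : mkset _ = (fun w => `|V n z w - a n|) @^-1` `[t, +oo[).
      by rewrite -[X in measurable X]setTI; exact: mn.
    by apply/seteqP; split => w /=; rewrite in_itv/= andbT.
  move=> w /=; rewrite valueE => h.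
  have -> : V n z w - a n = n%:R * (n%:R^-1 * V n z w - n%:R^-1 * a n).
    by field; rewrite gt_eqF.
  rewrite normrM gtr0_norm// ler_pM2l//.
  have := ler_distD (n%:R^-1 * a n) (n%:R^-1 * V n z w) v.
  have := a_lim n0; rewrite -/e; move: h; lra.
apply: (le_trans (chernoffV z n0 t0)); rewrite lee_fin.
have e2 : n%:R * e ^+ 2 = ln n.+1%:R.
  by rewrite sqr_log_rate; field; rewrite gt_eqF.
have l2 : 0 < n.+1%:R :> R by rewrite ltr0n.
(* With [ln n.+1 = n * e ^+ 2] this reduces to expanding the square in [t]. The extra [ln n.+1]
   yields the factor [2 / n.+1], at most 1. *)
have ht : (4 * C)^-1 * lambda ^+ 2 * n%:R + ln n.+1%:R <= t ^+ 2 / (4 * C * n%:R).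
  have -> : t ^+ 2 / (4 * C * n%:R) =
      (4 * C)^-1 * (n%:R * (lambda + (4 * C + 1) * e) ^+ 2).
    by rewrite /t; field; rewrite !gt_eqF.
  rewrite -e2.
  have -> : (4 * C)^-1 * lambda ^+ 2 * n%:R + n%:R * e ^+ 2 =
      (4 * C)^-1 * (n%:R * (lambda ^+ 2 + 4 * C * e ^+ 2)).
    by field; rewrite !gt_eqF.
  rewrite ler_pM2l ?invr_gt0 ?mulr_gt0//.
  rewrite ler_pM2l//.
  have h1 : 0 <= lambda * (C * e) by rewrite !mulr_ge0// ltW.
  have h2 : 0 <= lambda * e by rewrite mulr_ge0.
  have h3 : 0 <= C * e ^+ 2 by rewrite mulr_ge0 ?sqr_ge0 ?ltW.
  have h4 : 0 <= (C * e) ^+ 2 by rewrite sqr_ge0.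
  have h5 : 0 <= e ^+ 2 by rewrite sqr_ge0.
  by lra.
apply: (@le_trans _ _ (2 * expR (- ((4 * C)^-1 * lambda ^+ 2 * n%:R + ln n.+1%:R)))).
  by rewrite ler_pM2l// ler_expR lerN2.
rewrite opprD expRD (expRN (ln _)) lnK ?posrE// mulrCA ler_piMr ?expR_ge0//.
by rewrite ler_pdivrMr// mul1r ler_nat.
Qed.

(* Borel-Cantelli with lambda^2 = (2 / B) * ln (n + 1) / n, which makes the
   exponential bound equal to (n + 1)^(-2). *)
Lemma value_ae_cvg z : {ae P, forall w, value G n w z @[n --> \oo] --> v}.
Proof.
set A := 4 * C + 1 + D; pose B := (4 * C)^-1.
have A0 : 0 <= A by rewrite !addr_ge0// mulr_ge0// ltW.
have B0 : 0 < B by rewrite invr_gt0 mulr_gt0.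
pose c := Num.sqrt (2 / B); have c0 : 0 <= c by exact: sqrtr_ge0.
have c2 : c ^+ 2 = 2 / B by rewrite sqr_sqrtr// divr_ge0// ltW.
(* The index is shifted because the concentration bound requires at least one stage. *)
pose F n := [set w | ((c + A) * log_rate n.+1 <= `|value G n.+1 w z - v|)%R].
have mF n : measurable (F n) by exact: measurable_deviation.
(* The bound [n.+2 ^ (-2)] is replaced by a telescoping difference, so the series sums to at most
   1. *)
have PF n : (P (F n) <= (n.+1%:R^-1 - n.+2%:R^-1 : R)%:E)%E.
  have := @value_concentration n.+1 z (c * log_rate n.+1) isT.
  rewrite -mulrDl => h; apply: (le_trans (h _)); first by rewrite mulr_ge0 ?log_rate_ge0.
  rewrite lee_fin -/B exprMn sqr_log_rate c2.
  have -> : B * (2 / B * (ln n.+2%:R / n.+1%:R)) * n.+1%:R = 2%:R * ln n.+2%:R.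
    by field; rewrite !gt_eqF// ltr0n.
  rewrite expRN expRM_natl lnK ?posrE ?ltr0n//.
  have n1 : 0 < n.+1%:R :> R by rewrite ltr0n.
  have n2 : 0 < n.+2%:R :> R by rewrite ltr0n.
  have -> : n.+1%:R^-1 - n.+2%:R^-1 = (n.+1%:R * n.+2%:R)^-1 :> R.
    rewrite -(@natr1 _ n.+1); move: n1; move: (n.+1%:R : R) => x x0.
    by field; apply/andP; split; rewrite gt_eqF//; lra.
  by rewrite lef_pV2 ?posrE ?mulr_gt0 ?exprn_gt0// expr2 ler_pM2r// ler_nat.
have sumF : (\sum_(n <oo) P (F n) < +oo)%E.
  apply: (@le_lt_trans _ _ 1%:E); last exact: ltry.
  apply: lime_le; first exact: is_cvg_nneseries.
  apply: nearW => n; rewrite big_mkord.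
  apply: (@le_trans _ _ (\sum_(i < n) (i.+1%:R^-1 - i.+2%:R^-1 : R)%:E)%E).
    by apply: lee_sum => i _; exact: PF.
  rewrite sumEFin lee_fin.
  suff -> : \sum_(i < n) (i.+1%:R^-1 - i.+2%:R^-1 : R) = 1 - n.+1%:R^-1.
    by rewrite gerBl invr_ge0.
  elim: n => [|n IH]; first by rewrite big_ord0 invr1 subrr.
  by rewrite big_ord_recr/= IH; ring.
have PF0 := lim_sup_set_cvg0 mF sumF.
exists (lim_sup_set F); split => //.
  apply: bigcap_measurable => // k _; exact: bigcup_measurable.
move=> w /= wF; apply: contrapT => Fw; apply: wF.
(* Outside the limit superior, [w] belongs to only finitely many [F j]. *)
have [N _ NF] : exists2 N, True & forall j, (N <= j)%N -> ~ F j w.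
  apply: contrapT => h; apply: Fw => N _; apply: contrapT => h'; apply: h; exists N => //.
  by move=> j Nj Fj; apply: h'; exists j.
apply/cvgrPdist_le => e e0.
have cA0 : 0 < c + A + 1 by rewrite ltr_wpDl// addr_ge0.
have [N' hN'] := log_rate_small (divr_gt0 e0 cA0).
exists (maxn N N').+1 => // n /=; case: n => [//|n]; rewrite ltnS geq_max => /andP[Nn N'n].
rewrite distrC; have /negP := NF n Nn; rewrite -ltNge => /ltW/le_trans; apply.
have := hN' n.+1 N'n; rewrite ler_pdivlMr// mulrC mulrDl => /(le_trans _); apply.
by rewrite lerDl mul1r log_rate_ge0.
Qed.

End conclusion.

Theorem theorem2p3 (R : realType) (d : nat) (I J : finType)
    (disp : measure_display) (Omega : measurableType disp)
    (P : probability Omega R) (G : percolation_game d I J P) :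
  (1 <= d)%N -> iid G -> oriented G ->
  exists v_infty : R,
  [/\ forall z : 'rV[int]_d,
        {ae P, forall w, value G n w z @[n --> \oo] --> v_infty},
      exists A B : R, [/\ 0 < A, 0 < B &
        forall (n : nat) (z : 'rV[int]_d) (lambda : R),
          (1 <= n)%N -> 0 <= lambda ->
          (P [set w | (`|value G n w z - v_infty| >=
                       lambda + A * ln n.+1%:R `^ 2^-1 * n%:R `^ (- 2^-1))%R]
           <= (expR (- (B * lambda ^+ 2 * n%:R)))%:E)%E],
      forall (n : nat) (z z' : 'rV[int]_d), (1 <= n)%N ->
        ('E_P[fun w => value G n w z] = 'E_P[fun w => value G n w z'])%E
    & forall z : 'rV[int]_d,
        ('E_P[fun w => value G n w z] @[n --> \oo] --> v_infty%:E)%E /\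
        (fun n : nat => fine ('E_P[fun w => value G n w z])%E - v_infty : R^o)
          =O_\oo (fun n : nat => ln n%:R * n%:R `^ (- 2^-1) : R^o)].
Proof.
move=> _ [indepG _] [u qu].
have [i0 _] := card_gt0P (pg_I_nonempty G).
have [j0 _] := card_gt0P (pg_J_nonempty G).
have [M0 gM0] := pg_g_bounded G.
(* [M] and [D] are made strictly positive so that [C], which occurs in denominators, is too. *)
pose M := `|M0| + 1; have M1 : 0 < M by rewrite ltr_wpDl.
have gM w z i j : `|pg_g G w z i j| <= M.
  by apply: (le_trans (gM0 w z i j)); rewrite -[leLHS]addr0 lerD// ler_norm.
pose D := (\sum_(p : I * J) `|dotz (pg_q G p.1 p.2) u|).+1%N.
have qD i j : dotz (pg_q G i j) u <= D%:Z.
  rewrite (le_trans (ler_norm _))// -abszE lez_nat /D leqW//.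
  by rewrite (bigD1 (i, j))//= leq_addr.
pose C := mgf_constant M D.
have C0 : 0 < C by rewrite !mulr_gt0 ?exprn_gt0// ltr0n.
have E0 : 0 <= #|{: I * J}|%:R + C by rewrite addr_ge0// ltW.
have bV n z := bmeas_game_dyn i0 j0 gM n z.
have meanV n z := mean_game_dyn i0 j0 gM n z.
have [v a_lim] := almost_additive_limit E0
  (game_mean_almost_additive i0 j0 gM qu qD (ltW M1) indepG).
have chernoffV n z t n0 t0 :=
  @chernoff_game_dyn _ _ _ _ _ _ _ G i0 j0 M gM u D qu qD (ltW M1) indepG n z t n0 t0 C0.
set D' := 32 * _ in a_lim; have D0 : 0 <= D' by rewrite mulr_ge0.
exists v; split.
- by move=> z; exact: (value_ae_cvg D0 bV a_lim C0 chernoffV).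
- exists (4 * C + 1 + D'), (4 * C)^-1; split.
  + by rewrite ltr_pwDl// ltr_pwDr// mulr_ge0// ltW.
  + by rewrite invr_gt0 mulr_gt0.
  move=> n z lambda n0 l0; rewrite -mulrA log_rate_powR//.
  exact: (value_concentration bV a_lim C0 chernoffV).
- by move=> n z z' n0; rewrite !(expectation_value bV meanV).
- move=> z; split; first exact: (expectation_value_cvg D0 bV meanV a_lim).
  exact: (expectation_value_bigO D0 bV meanV a_lim).
Qed.
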